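(* The assignment $\xi$ sending an ordered Gleason space $(X,\le,R)$ to the compact pospace $(X/{\equiv},\le_R)$, and sending a morphism $\rho\subseteq X\times Y$ of $\mathbf{OGlSp}$ (from $X$ to $Y$) to the map $f_\rho:X/{\equiv}\to Y/{\equiv}$, $x^{\equiv}\mapsto y^{\equiv}$ for $y$ $R$-minimal in $\rho[x,-]$, is a functor $\xi:\mathbf{OGlSp}\to\mathbf{KPSp}$, and it is an equivalence between the categories $\mathbf{OGlSp}$ and $\mathbf{KPSp}$.
   Context: **Compact pospaces.** A compact pospace is a compact space $P$ with a partial order that is closed in $P^2$. $\mathbf{KPSp}$ is the category of compact pospaces and continuous monotone maps. **Ordered Gleason spaces.** For a Priestley space $X$, $\mathrm{Clop}^{\uparrow}(X)$ denotes the lattice of clopen upsets ordered by inclusion, and $\mathrm{cl}$, $\mathrm{int}$ denote closure and interior. An f-space is a Priestley space in which the closure of every open upset is an open upset. For a relation $R\subseteq X\times Y$ and $E\subseteq Y$, $F\subseteq X$: $R[-,E]=\{x\mid\exists y\in E: x\mathrel R y\}$, $R[F,-]=\{y\mid\exists x\in F: x\mathrel R y\}$, with $R[x,-]=R[\{x\},-]$; $(\cdot)^c$ is the complement. An ordered Gleason space is a triple $(X,\le,R)$ where $(X,\le)$ is an f-space and $R$ is a binary relation on $X$ such that: (1) $R$ is closed in $X^2$; (2) $x\le y\mathrel R z\le t$ implies $x\mathrel R t$; (3) $R$ is a pre-order; (4) $O=\mathrm{cl}(R[-,O^c]^c)$ for every $O\in\mathrm{Clop}^{\uparrow}(X)$.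 On $\mathrm{Clop}^{\uparrow}(X)$ one puts the relation $O\prec U$ iff $R[O,-]\subseteq U$. The equivalence relation $\equiv$ on $X$ is: $x\equiv y$ iff $x\mathrel R y$ and $y\mathrel R x$; $x^{\equiv}$ is the class of $x$. The quotient $X/{\equiv}$ carries the quotient topology and the order $x^{\equiv}\le_R y^{\equiv}$ iff $x\mathrel R y$. An element $x$ of a subset $S$ of an ordered Gleason space is $R$-minimal in $S$ if for every $y\in S$, $y\mathrel R x$ implies $x\mathrel R y$. **Morphisms.** A strong meet-hemirelation from $X$ to $Y$ (ordered Gleason spaces) is a relation $\rho\subseteq X\times Y$ such that: (1) $x_1\le x_2\mathrel\rho y_1\le y_2$ implies $x_1\mathrel\rho y_2$; (2) $\rho$ is closed in $X\times Y$; (3) $O\in\mathrm{Clop}^{\uparrow}(Y)$ implies $\rho[-,O^c]^c\in\mathrm{Clop}^{\uparrow}(X)$; (4) $\rho[x,-]\ne\emptyset$ for every $x\in X$. - Ordered forth condition (ofc): for all $x_1,x_2\in X$, every $y_1$ $R$-minimal in $\rho[x_1,-]$ and every $y_2\in Y$, if $x_1\mathrel\rho y_1$, $x_1\mathrel R x_2$ and $x_2\mathrel\rho y_2$, then $y_1\mathrel R y_2$. - De Vries condition (dvc): $\rho[-,O^c]=\mathrm{int}(\rho[-,R[-,O^c]])$ for every $O\in\mathrm{Clop}^{\uparrow}(Y)$. Meet-hemirelations $\rho\subseteq X\times Y$ correspond to meet-preserving maps $h:\mathrm{Clop}^{\uparrow}(Y)\to\mathrm{Clop}^{\uparrow}(X)$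 via $h(O)=\rho[-,O^c]^c$ and, conversely, $x\mathrel\rho y$ iff for all $O\in\mathrm{Clop}^{\uparrow}(Y)$, $x\in h(O)$ implies $y\in O$. If $\rho_2\subseteq X\times Y$ and $\rho_1\subseteq Y\times Z$ have associated maps $h_2,h_1$, the composition $\rho_1\star\rho_2\subseteq X\times Z$ is the relation associated to $h_2\star h_1$, where $(h_2\star h_1)(O)=\bigvee\{h_2(h_1(U))\mid U\prec O\}$ for $O \in \mathrm{Clop}^{\uparrow}(Z)$ (join computed in $\mathrm{Clop}^{\uparrow}(X)$). $\mathbf{OGlSp}$ is the category of ordered Gleason spaces with strong meet-hemirelations satisfying the ofc and the dvc, with this composition; the identity morphism of $(X,\le,R)$ is the relation $\le$. *)

(* Defs.v *)
From mathcomp Require Import all_boot all_classical topology.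
From Corelib Require Relations.Relation_Definitions.

Set Implicit Arguments.
Unset Strict Implicit.
Unset Printing Implicit Defensive.

Local Open Scope classical_set_scope.
Local Open Scope quotient_scope.

(** * Categories, functors, equivalences *)

(* Morphisms are compared with Leibniz equality; [comp g f] is [g] after [f]. *)
Record category := Category {
  Obj :> Type;
  Hom : Obj -> Obj -> Type;
  idm : forall A, Hom A A;
  comp : forall A B C, Hom B C -> Hom A B -> Hom A C;
  comp_idl : forall A B (f : Hom A B), comp (idm B) f = f;
  comp_idr : forall A B (f : Hom A B), comp f (idm A) = f;
  comp_assoc : forall A B C D (h : Hom C D) (g : Hom B C) (f : Hom A B),
    comp h (comp g f) = comp (comp h g) f }.

Arguments Hom {c}.
Arguments idm {c}.
Arguments comp {c A B C}.

Record is_functor (C D : category) (F0 : C -> D)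
    (F1 : forall A B : C, Hom A B -> Hom (F0 A) (F0 B)) : Prop := IsFunctor {
  functor_id : forall A, F1 A A (idm A) = idm (F0 A);
  functor_comp : forall A B E (g : Hom B E) (f : Hom A B),
    F1 A E (comp g f) = comp (F1 B E g) (F1 A B f) }.

Record functor (C D : category) := Functor {
  fobj :> C -> D;
  fmap : forall A B : C, Hom A B -> Hom (fobj A) (fobj B);
  fmapP : is_functor fmap }.

Arguments fmap {C D} f {A B}.

Lemma functor_id_subproof (C : category) :
  @is_functor C C (fun A => A) (fun A B f => f).
Proof. by []. Qed.

Definition functor_one (C : category) : functor C C :=
  Functor (functor_id_subproof C).

Lemma functor_comp_subproof (C D E : category)
    (G : functor D E) (F : functor C D) :
  @is_functor C E (fun A => G (F A)) (fun A B f => fmap G (fmap F f)).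
Proof.
split=> [A|A B X g f].
  by rewrite (functor_id (fmapP F)) (functor_id (fmapP G)).
by rewrite (functor_comp (fmapP F)) (functor_comp (fmapP G)).
Qed.

Definition functor_after (C D E : category)
    (G : functor D E) (F : functor C D) : functor C E :=
  Functor (functor_comp_subproof G F).

Definition is_iso (C : category) (A B : C) (f : Hom A B) : Prop :=
  exists g : Hom B A, comp g f = idm A /\ comp f g = idm B.

Definition naturally_isomorphic (C D : category) (F G : functor C D) : Prop :=
  exists eta : forall A : C, Hom (F A) (G A),
    (forall (A B : C) (f : Hom A B),
        comp (eta B) (fmap F f) = comp (fmap G f) (eta A)) /\
    (forall A : C, is_iso (eta A)).

Definition is_equivalence (C D : category) (F : functor C D) : Prop :=
  exists G : functor D C,
    naturally_isomorphic (functor_after G F) (functor_one C) /\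
    naturally_isomorphic (functor_after F G) (functor_one D).

(** * Relations *)

Definition rpre (X Y : Type) (R : X -> Y -> Prop) (E : set Y) : set X :=
  [set x | exists2 y, E y & R x y].

Definition rimg (X Y : Type) (R : X -> Y -> Prop) (F : set X) : set Y :=
  [set y | exists2 x, F x & R x y].

(* R[-, O^c]^c; for a meet-hemirelation R this is the map h associated to R. *)
Definition rbox (X Y : Type) (R : X -> Y -> Prop) (O : set Y) : set X :=
  ~` rpre R (~` O).

Definition upset (X : Type) (le : X -> X -> Prop) (A : set X) : Prop :=
  forall x y, A x -> le x y -> A y.

Definition closed_rel (X Y : topologicalType) (R : X -> Y -> Prop) : Prop :=
  closed [set p : X * Y | R p.1 p.2].

Definition minimal_in (X : Type) (R : X -> X -> Prop) (S : set X) (x : X) :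
    Prop :=
  S x /\ forall y, S y -> R y x -> R x y.

(** * Compact pospaces *)

Record is_compact_pospace (P : topologicalType) (le : P -> P -> Prop) : Prop :=
  IsCompactPospace {
    kps_compact : compact [set: P];
    kps_order : Relation_Definitions.order P le;
    kps_closed : closed_rel le }.

Record compact_pospace := CompactPospace {
  kps_carrier :> topologicalType;
  kps_le : kps_carrier -> kps_carrier -> Prop;
  kps_axioms : is_compact_pospace kps_le }.

Definition is_kps_morphism (P Q : compact_pospace) (f : P -> Q) : Prop :=
  continuous f /\ forall x y, kps_le x y -> kps_le (f x) (f y).

Definition kps_hom (P Q : compact_pospace) : Type :=
  {f : P -> Q | is_kps_morphism f}.

Lemma kps_id_subproof (P : compact_pospace) : @is_kps_morphism P P id.
Proof. by split=> // x; exact: cvg_id. Qed.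

Lemma kps_comp_subproof (P Q S : compact_pospace)
    (g : kps_hom Q S) (f : kps_hom P Q) :
  is_kps_morphism (sval g \o sval f).
Proof.
case: g f => [g [cg mg]] [f [cf mf]]; split=> /= [x|x y /mf /mg //].
by apply: continuous_comp; [exact: cf|exact: cg].
Qed.

Lemma sval_inj (T : Type) (P : T -> Prop) (u v : {x : T | P x}) :
  sval u = sval v -> u = v.
Proof. by case: u v => [u pu] [v pv] /= E; exact: eq_exist. Qed.

Definition KPSp : category.
Proof.
refine (@Category compact_pospace kps_hom
  (fun P => exist _ _ (kps_id_subproof P))
  (fun P Q S g f => exist _ _ (kps_comp_subproof g f)) _ _ _).
- by move=> P Q f; exact: sval_inj.
- by move=> P Q f; exact: sval_inj.
- by move=> P Q S T h g f; exact: sval_inj.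
Defined.

(** * Ordered Gleason spaces *)

Section Clopup.
Variables (X : topologicalType) (le : X -> X -> Prop).

Definition clopup : set (set X) := [set O | clopen O /\ upset le O].

Record is_priestley : Prop := IsPriestley {
  priestley_compact : compact [set: X];
  priestley_order : Relation_Definitions.order X le;
  priestley_sep : forall x y, ~ le x y ->
    exists O, [/\ clopup O, O x & ~ O y] }.

Record is_fspace : Prop := IsFspace {
  fspace_priestley : is_priestley;
  fspace_closure : forall U, open U -> upset le U ->
    open (closure U) /\ upset le (closure U) }.

Definition clopup_sup (S : set (set X)) (W : set X) : Prop :=
  [/\ clopup W,
      forall V, S V -> V `<=` W
    & forall W', clopup W' -> (forall V, S V -> V `<=` W') -> W `<=` W'].

(* The join of S in the lattice of clopen upsets (set0 if it does not exist);
   over an f-space it always exists, see clopup_joinE. *)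
Definition clopup_join (S : set (set X)) : set X := xget set0 (clopup_sup S).

Lemma clopup_joinE (S : set (set X)) : is_fspace -> S `<=` clopup ->
  clopup_join S = closure (\bigcup_(V in S) V).
Proof.
move=> [_ fX] SX; have [||oC uC] := fX (\bigcup_(V in S) V).
- by apply: bigcup_open => V /SX [[]].
- by move=> x y [V SV Vx] xy; exists V => //; have [_ uV] := SX _ SV; exact: uV xy.
have supC : clopup_sup S (closure (\bigcup_(V in S) V)).
  split; first by split=> //; split=> //; exact: closed_closure.
  - by move=> V SV x Vx; apply: subset_closure; exists V.
  - move=> W' [[_ cW'] _] SW'; move/closure_id: cW' => ->.
    apply: closureS.
    by move=> x [V SV Vx]; exact: SW' Vx.
rewrite /clopup_join; case: xgetP => [W _ [cW SW Wmin]|/(_ _ supC)//].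
case: supC => cC SC Cmin; apply/seteqP; split; first exact: Wmin.
exact: Cmin.
Qed.

End Clopup.

Record is_ordered_gleason (X : topologicalType) (le R : X -> X -> Prop) : Prop :=
  IsOrderedGleason {
    ogl_fspace : is_fspace le;
    ogl_closed : closed_rel R;
    ogl_le_R_le : forall x y z t, le x y -> R y z -> le z t -> R x t;
    ogl_preorder : Relation_Definitions.preorder X R;
    ogl_dense : forall O, clopup le O -> O = closure (rbox R O) }.

Record ordered_gleason := OrderedGleason {
  ogl_carrier :> topologicalType;
  ogl_le : ogl_carrier -> ogl_carrier -> Prop;
  ogl_R : ogl_carrier -> ogl_carrier -> Prop;
  ogl_axioms : is_ordered_gleason ogl_le ogl_R }.

Definition Clopup (X : ordered_gleason) : set (set X) := clopup (@ogl_le X).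

Definition ogl_prec (X : ordered_gleason) (O U : set X) : Prop :=
  rimg (@ogl_R X) O `<=` U.

(** * Morphisms of ordered Gleason spaces *)

Section Morphisms.
Variables X Y : ordered_gleason.
Implicit Type rho : X -> Y -> Prop.

Record is_strong_meet_hemirelation rho : Prop := IsStrongMeetHemirelation {
  smh_le : forall x1 x2 y1 y2,
    ogl_le x1 x2 -> rho x2 y1 -> ogl_le y1 y2 -> rho x1 y2;
  smh_closed : closed_rel rho;
  smh_clopup : forall O, Clopup O -> Clopup (rbox rho O);
  smh_strong : forall x, rho x !=set0 }.

Definition ordered_forth rho : Prop :=
  forall x1 x2 y1 y2, minimal_in (@ogl_R Y) (rho x1) y1 ->
    rho x1 y1 -> ogl_R x1 x2 -> rho x2 y2 -> ogl_R y1 y2.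

Definition de_vries rho : Prop :=
  forall O, Clopup O ->
    rpre rho (~` O) = interior (rpre rho (rpre (@ogl_R Y) (~` O))).

Definition is_ogl_morphism rho : Prop :=
  [/\ is_strong_meet_hemirelation rho, ordered_forth rho & de_vries rho].

Definition ogl_hom : Type := {rho : X -> Y -> Prop | is_ogl_morphism rho}.

End Morphisms.

Section Composition.
Variables X Y Z : ordered_gleason.
Variables (rho1 : Y -> Z -> Prop) (rho2 : X -> Y -> Prop).

(* The map h2 * h1, where h1 and h2 are associated to rho1 and rho2. *)
Definition star_map (O : set Z) : set X :=
  clopup_join (@ogl_le X)
    [set rbox rho2 (rbox rho1 U) | U in [set U | Clopup U /\ ogl_prec U O]].

Definition star (x : X) (z : Z) : Prop :=
  forall O, Clopup O -> star_map O x -> O z.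

End Composition.

(* With [star] as composition and the orders as identities, ordered Gleason
   spaces form a category. *)
Record OGlSp_laws : Prop := OGlSpLaws {
  ogl_id_morphism : forall X : ordered_gleason, is_ogl_morphism (@ogl_le X);
  ogl_star_morphism : forall (X Y Z : ordered_gleason)
      (rho1 : Y -> Z -> Prop) (rho2 : X -> Y -> Prop),
    is_ogl_morphism rho1 -> is_ogl_morphism rho2 ->
    is_ogl_morphism (star rho1 rho2);
  ogl_star_idl : forall (X Y : ordered_gleason) (rho : X -> Y -> Prop),
    is_ogl_morphism rho -> star (@ogl_le Y) rho = rho;
  ogl_star_idr : forall (X Y : ordered_gleason) (rho : X -> Y -> Prop),
    is_ogl_morphism rho -> star rho (@ogl_le X) = rho;
  ogl_star_assoc : forall (X Y Z T : ordered_gleason)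
      (rho1 : Z -> T -> Prop) (rho2 : Y -> Z -> Prop) (rho3 : X -> Y -> Prop),
    is_ogl_morphism rho1 -> is_ogl_morphism rho2 -> is_ogl_morphism rho3 ->
    star rho1 (star rho2 rho3) = star (star rho1 rho2) rho3 }.

Definition OGlSp (L : OGlSp_laws) : category.
Proof.
refine (@Category ordered_gleason ogl_hom
  (fun X => exist _ _ (ogl_id_morphism L X))
  (fun X Y Z rho1 rho2 =>
     exist _ _ (ogl_star_morphism L (svalP rho1) (svalP rho2))) _ _ _).
- by move=> X Y rho; apply: sval_inj; exact: ogl_star_idl (svalP rho).
- by move=> X Y rho; apply: sval_inj; exact: ogl_star_idr (svalP rho).
- move=> X Y Z T r1 r2 r3; apply: sval_inj.
  exact: ogl_star_assoc (svalP r1) (svalP r2) (svalP r3).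
Defined.

(** * The quotient pospace *)

Lemma priestley_hausdorff (X : topologicalType) (le : X -> X -> Prop) :
  is_priestley le -> hausdorff_space X.
Proof.
move=> [_ [_ _ anti] sep]; rewrite open_hausdorff => x y.
wlog nxy : x y / ~ le x y => [IH xy|xy].
  have [lexy|] := pselect (le x y); last by move=> nxy; exact: IH.
  have [leyx|nyx] := pselect (le y x).
    by move: xy; rewrite (anti _ _ lexy leyx) eqxx.
  have [|[A B] [/= yA xB] [oA oB AB]] := IH y x nyx; first by rewrite eq_sym.
  by exists (B, A); split=> //=; rewrite setIC.
have [O [[[oO cO] _] Ox nOy]] := sep _ _ nxy.
exists (O, ~` O); split=> /=; rewrite ?inE//; first by rewrite openC.
by apply/eqP; rewrite setICr.
Qed.

Section ClosedRel.
Variables (X : topologicalType) (R : X -> X -> Prop).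
Hypotheses (hX : hausdorff_space X) (cX : compact [set: X]).
Hypothesis cR : closed_rel R.

Lemma closed_image_proj (p : X * X -> X) (A : set (X * X)) :
  continuous p -> closed A -> closed (p @` A).
Proof.
move=> cp cA; apply: compact_closed => //; apply: continuous_compact.
  by apply: continuous_subspaceT => z; exact: cp.
by apply: subclosed_compact cA (compact_setX cX cX) _ => -[].
Qed.

Lemma closed_rpre (K : set X) : closed K -> closed (rpre R K).
Proof.
move=> cK; have -> : rpre R K =
    fst @` ([set p : X * X | R p.1 p.2] `&` (snd @^-1` K)).
  apply/seteqP; split=> [x [y Ky xy]|x [[u v] [/= uv Kv] <-]]; last by exists v.
  by exists (x, y).
apply: closed_image_proj => [z|]; first exact: cvg_fst.
by apply: closedI cR _; apply: preimage_closed cK => z _; exact: cvg_snd.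
Qed.

Lemma closed_rimg (K : set X) : closed K -> closed (rimg R K).
Proof.
move=> cK; have -> : rimg R K =
    snd @` ([set p : X * X | R p.1 p.2] `&` (fst @^-1` K)).
  apply/seteqP; split=> [y [x Kx xy]|y [[u v] [/= uv Kv] <-]]; last by exists u.
  by exists (x, y).
apply: closed_image_proj => [z|]; first exact: cvg_snd.
by apply: closedI cR _; apply: preimage_closed cK => z _; exact: cvg_fst.
Qed.

End ClosedRel.

Section Quotient.
Variable X : ordered_gleason.
Local Notation R := (@ogl_R X).

Definition ogl_equiv (x y : X) : bool := `[< R x y /\ R y x >].

Lemma ogl_equiv_refl : ssrbool.reflexive ogl_equiv.
Proof. by move=> x; apply/asboolP; have [] := ogl_preorder (ogl_axioms X). Qed.

Lemma ogl_equiv_sym : ssrbool.symmetric ogl_equiv.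
Proof. by move=> x y; apply/asboolP/asboolP => -[]. Qed.

Lemma ogl_equiv_trans : ssrbool.transitive ogl_equiv.
Proof.
move=> y x z /asboolP[xy yx] /asboolP[yz zy]; apply/asboolP.
have [_ tR] := ogl_preorder (ogl_axioms X).
by split; [exact: tR xy yz|exact: tR zy yx].
Qed.

Canonical ogl_equiv_equiv :=
  EquivRel ogl_equiv ogl_equiv_refl ogl_equiv_sym ogl_equiv_trans.

Definition ogl_quot : topologicalType :=
  quotient_topology {eq_quot ogl_equiv_equiv}.

Definition ogl_class (x : X) : ogl_quot := \pi_{eq_quot ogl_equiv_equiv} x.

(* By ogl_quot_leE this does not depend on the representatives. *)
Definition ogl_quot_le (a b : ogl_quot) : Prop :=
  R (repr (a : {eq_quot ogl_equiv_equiv}))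
    (repr (b : {eq_quot ogl_equiv_equiv})).

Lemma ogl_classP (x y : X) : ogl_class x = ogl_class y <-> R x y /\ R y x.
Proof.
have E := @eqmodP X ogl_equiv_equiv x y.
by split=> [/E /asboolP|xy]; [|exact/E/asboolP].
Qed.

Lemma ogl_class_repr (a : ogl_quot) :
  ogl_class (repr (a : {eq_quot ogl_equiv_equiv})) = a.
Proof. exact: (@reprK _ {eq_quot ogl_equiv_equiv} a). Qed.

Lemma ogl_class_surj (a : ogl_quot) : exists x, a = ogl_class x.
Proof. by exists (repr (a : {eq_quot ogl_equiv_equiv})); rewrite ogl_class_repr. Qed.

Lemma ogl_quot_leE (x y : X) :
  ogl_quot_le (ogl_class x) (ogl_class y) <-> R x y.
Proof.
have [_ tR] := ogl_preorder (ogl_axioms X).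
have /ogl_classP[x1 x2] := ogl_class_repr (ogl_class x).
have /ogl_classP[y1 y2] := ogl_class_repr (ogl_class y).
by split=> [H|H]; [exact: tR (tR _ _ _ x2 H) y1|exact: tR (tR _ _ _ x1 H) y2].
Qed.

Lemma ogl_class_continuous : continuous ogl_class.
Proof. exact: pi_continuous. Qed.

Lemma ogl_quot_open (U : set ogl_quot) : open (ogl_class @^-1` U) -> open U.
Proof. by []. Qed.

Lemma ogl_quot_le_closed : closed_rel ogl_quot_le.
Proof.
have [[pX _] cR _ [rR tR] _] := ogl_axioms X.
have hX := priestley_hausdorff pX; have cX := priestley_compact pX.
have nX := compact_normal hX cX.
have sep x y : ~ R x y -> exists U V : set X, [/\ open U, open V,
    R x `<=` U, (fun z => R z y) `<=` V & U `&` V = set0].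
  move=> nxy; have cA : closed (R x).
    suff -> : R x = rimg R [set x].
      by apply: closed_rimg => //; exact/accessible_closed_set1/hausdorff_accessible.
    by apply/seteqP; split=> [z xz|z [_ -> //]]; exists x.
  have cB : closed (fun z => R z y).
    suff -> : (fun z => R z y) = rpre R [set y].
      by apply: closed_rpre => //; exact/accessible_closed_set1/hausdorff_accessible.
    by apply/seteqP; split=> [z xz|z [_ -> //]]; exists y.
  have /set_nbhsP[C [oC AC CB]] : set_nbhs (R x) (~` (fun z => R z y)).
    apply/set_nbhsP; exists (~` (fun z => R z y)); split=> //.
      by rewrite openC.
    by move=> z xz /= zy; apply: nxy; exact: tR xz zy.
  have [|D] := nX _ cA C; first by apply/set_nbhsP; exists C; split.
  move=> /set_nbhsP[E [oE AE ED]] DC.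
  exists E, (~` closure D); split=> //; first by rewrite openC; exact: closed_closure.
    by move=> z zy /DC /CB; exact.
  apply/seteqP; split=> // z [/ED zD]; apply; exact: subset_closure.
rewrite /closed_rel -openC openE => -[a b] /=.
have [x ->] := ogl_class_surj a; have [y ->] := ogl_class_surj b => nab.
have [U [V [oU oV xU yV UV]]] : exists U V : set X, [/\ open U, open V,
    R x `<=` U, (fun z => R z y) `<=` V & U `&` V = set0].
  by apply: sep => xy; apply: nab => /=; apply/ogl_quot_leE.
pose A : set ogl_quot := [set c | forall z, ogl_quot_le c (ogl_class z) -> U z].
pose B : set ogl_quot := [set c | forall z, ogl_quot_le (ogl_class z) c -> V z].
exists (A, B); last first.
  move=> [c d] [/=]; have [u ->] := ogl_class_surj c.
  have [v ->] := ogl_class_surj d => Au Bv /= uv.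
  have Uv : U v by exact: Au.
  have Vv : V v by apply: Bv; exact/ogl_quot_leE.
  by have : set0 v by rewrite -UV.
split; apply: open_nbhs_nbhs; split.
- apply: ogl_quot_open; rewrite -closedC.
  suff -> : ~` (ogl_class @^-1` A) = rpre R (~` U).
    by apply: closed_rpre => //; rewrite closedC.
  apply/seteqP; split=> [u nAu|u [z nUz uz] Au].
    apply: contrapT => nu; apply: nAu => z /ogl_quot_leE uz.
    by apply: contrapT => nUz; apply: nu; exists z.
  by apply: nUz; apply: Au; exact/ogl_quot_leE.
- by move=> z /ogl_quot_leE; exact: xU.
- apply: ogl_quot_open; rewrite -closedC.
  suff -> : ~` (ogl_class @^-1` B) = rimg R (~` V).
    by apply: closed_rimg => //; rewrite closedC.
  apply/seteqP; split=> [u nBu|u [z nVz zu] Bu].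
    apply: contrapT => nu; apply: nBu => z /ogl_quot_leE zu.
    by apply: contrapT => nVz; apply: nu; exists z.
  by apply: nVz; apply: Bu; exact/ogl_quot_leE.
- by move=> z /ogl_quot_leE; exact: yV.
Qed.

Lemma ogl_quot_pospace : is_compact_pospace ogl_quot_le.
Proof.
have [[[cX _ _] _] _ _ [rR tR] _] := ogl_axioms X.
split; last exact: ogl_quot_le_closed.
- suff -> : [set: ogl_quot] = ogl_class @` [set: X].
    apply: continuous_compact cX; apply: continuous_subspaceT.
    exact: ogl_class_continuous.
  by apply/seteqP; split=> // a _; have [x ->] := ogl_class_surj a; exists x.
- split=> [a|a b c|a b ab ba]; [exact: rR|exact: tR|].
  by rewrite -(ogl_class_repr a) -(ogl_class_repr b); exact/ogl_classP.
Qed.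

Definition xi_obj : compact_pospace := CompactPospace ogl_quot_pospace.

End Quotient.

Definition induces (X Y : ordered_gleason) (rho : X -> Y -> Prop)
    (f : xi_obj X -> xi_obj Y) : Prop :=
  forall x : X,
    (exists y, minimal_in (@ogl_R Y) (rho x) y) /\
    (forall y, minimal_in (@ogl_R Y) (rho x) y ->
       f (ogl_class x) = ogl_class y).

(* Main.v *)
(* Ordered Gleason spaces and compact pospaces are matched hom-set by hom-set.
   Write [pi : X -> X/==] for the quotient map and [#O = {y | R[y,-] <= O}]; the
   axiom [O = cl #O] and the de Vries condition say that a morphism [rho] is
   determined by the open sets [{x | rho[x,-] <= #O}].  By the ordered forth
   condition [f_rho (pi x)] is the least class meeting [rho[x,-]], so this set is
   [{x | f_rho (pi x) \in pi(#O)}].  Hence [rho] is recovered from [f_rho] by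
   [h(O) = cl {x | f_rho (pi x) \in pi(#O)}], and the same formula turns every
   continuous monotone [f] into a morphism.  Under this bijection [star] becomes
   composition of maps and [le] the identity map, which yields the category laws,
   functoriality and full faithfulness at once.

   For essential surjectivity a compact pospace [P] is covered by the space of
   prime filters of its open upsets, with [x R y] iff [lim x <= lim y].  The
   principal filters of points of [P] are dense in a strong sense
   ([principal_dense]), which gives the f-space axiom and [O = cl #O]. *)
From HB Require Import structures.
From mathcomp Require Import all_boot all_classical topology.
From Corelib Require Relations.Relation_Definitions.
Require Import Defs.

Set Implicit Arguments.
Unset Strict Implicit.
Unset Printing Implicit Defensive.

Local Open Scope classical_set_scope.

(** * Compact spaces and closed preorders *)

Lemma compact_bigcap_neq0 (T : topologicalType) (D : set (set T)) :
  compact [set: T] -> D !=set0 ->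
  (forall A B, D A -> D B -> exists2 C, D C & C `<=` A `&` B) ->
  (forall A, D A -> closed A) -> (forall A, D A -> A !=set0) ->
  \bigcap_(A in D) A !=set0.
Proof.
move=> cT [A0 DA0] dirD clD D0.
have PF : ProperFilter (filter_from D id).
  apply: filter_from_proper; last by move=> A /D0.
  by apply: filter_from_filter; [exists A0|exact: dirD].
have [|x [_ clx]] := cT _ PF; first exact: filterT.
exists x => A DA; rewrite (closure_id A).1; last exact: clD.
by move=> B Bx; apply: clx => //; exists A.
Qed.

(** Compactness is used twice, first to separate [F] from one point outside [G], then from all of
    them. The lattice [B] of clopen sets is left arbitrary so that the result applies both to all
    clopen upsets and to the sets [stone_set U] alone. *)
Lemma closed_open_interpolation (T : topologicalType) (le : T -> T -> Prop)
    (B : set (set T)) (F G : set T) :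
  compact [set: T] ->
  B `<=` clopen -> B set0 -> B setT ->
  (forall U V, B U -> B V -> B (U `&` V)) ->
  (forall U V, B U -> B V -> B (U `|` V)) ->
  (forall x y, ~ le x y -> exists O, [/\ B O, O x & ~ O y]) ->
  closed F -> open G -> upset le G -> F `<=` G ->
  exists O, [/\ B O, F `<=` O & O `<=` G].
Proof.
move=> cT clB B0 BT BI BU sep cF oG uG FG.
(* Otherwise the closed sets [F \ O], directed because [B] is closed under unions, share a point
   [x]. As [G] is an upset containing [x] but not [y], [x] is not below [y], and a separating [O]
   excludes [x] from [F \ O]. *)
have step y : ~ G y -> exists O, [/\ B O, F `<=` O & ~ O y].
  move=> nGy; apply: contrapT => nO.
  have [||||x] := @compact_bigcap_neq0 T
      [set F `\` O | O in [set O | B O /\ ~ O y]] cT.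
  - by exists (F `\` set0); exists set0 => //; split.
  - move=> _ _ [U [BU1 nUy] <-] [V [BV nVy] <-]; exists (F `\` (U `|` V)).
      by exists (U `|` V) => //; split; [exact: BU|case].
    by move=> z [Fz nUV]; split; split=> // zO; apply: nUV; [left|right].
  - move=> _ [O [/clB[oO _] _] <-]; apply: closedI => //.
    exact: open_closedC.
  - move=> _ [O [BO nOy] <-]; apply: contrapT => E.
    apply: nO; exists O; split=> // z Fz; apply: contrapT => nOz.
    by apply: E; exists z.
  move=> xF; have [|O [BO Ox nOy]] := sep x y.
    by move=> xy; apply: nGy; apply: uG xy; apply: FG; have [] := xF (F `\` set0);
      first by exists set0 => //; split.
  by have [] : (F `\` O) x by apply: xF; exists O.
apply: contrapT => nO.
have [||||y] := @compact_bigcap_neq0 T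
    [set O `\` G | O in [set O | B O /\ F `<=` O]] cT.
- by exists (setT `\` G); exists setT.
- move=> _ _ [U [BU1 FU] <-] [V [BV FV] <-]; exists ((U `&` V) `\` G).
    exists (U `&` V) => //; split; first exact: BI.
    by move=> z Fz; split; [exact: FU|exact: FV].
  by move=> z [[Uz Vz] nGz].
- move=> _ [O [/clB[_ cO] _] <-]; apply: closedI => //.
  exact: open_closedC.
- move=> _ [O [BO FO] <-]; apply: contrapT => E.
  apply: nO; exists O; split=> // z Oz; apply: contrapT => nGz.
  by apply: E; exists z.
move=> yO; have [|O [BO FO nOy]] := step y.
  by have [] : (setT `\` G) y by apply: yO; exists setT.
by have [] : (O `\` G) y by apply: yO; exists O.
Qed.

(** Two points that no neighbourhoods separate form a pair in the closure of the diagonal, hence in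
    the closed order. This applies in both directions, and antisymmetry concludes. *)
Lemma closed_order_hausdorff (T : topologicalType) (le : T -> T -> Prop) :
  Relation_Definitions.order T le -> closed_rel le -> hausdorff_space T.
Proof.
move=> [rle _ anti] cle x y clxy.
suff H a b : cluster (nbhs a) b -> le a b.
  apply: anti; first exact: H.
  by apply: H => A B yA xB; rewrite setIC; exact: clxy.
move=> ab; have E := (closure_id _).1 cle.
suff : closure [set p : T * T | le p.1 p.2] (a, b) by rewrite -E.
move=> N [[A B] [/= aA bB] ABN].
have [z [Az Bz]] := ab _ _ aA bB.
by exists (z, z); split; [exact: rle|exact: ABN].
Qed.

Section ClosedPreorder.
Variables (T : topologicalType) (R : T -> T -> Prop).
Hypotheses (cT : compact [set: T]) (hT : hausdorff_space T).
Hypotheses (cR : closed_rel R) (pR : Relation_Definitions.preorder T R).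

Lemma closed_set1_hausdorff (x : T) : closed [set x].
Proof. exact/accessible_closed_set1/hausdorff_accessible. Qed.

Lemma closed_above (x : T) : closed (R x).
Proof.
suff -> : R x = rimg R [set x] by apply: closed_rimg => //; exact: closed_set1_hausdorff.
by apply/seteqP; split=> [z xz|z [_ -> //]]; exists x.
Qed.

Lemma closed_below (y : T) : closed (R^~ y).
Proof.
suff -> : R^~ y = rpre R [set y].
  by apply: closed_rpre => //; exact: closed_set1_hausdorff.
by apply/seteqP; split=> [z xz|z [_ -> //]]; exists y.
Qed.

Lemma open_rbox (G : set T) : open G -> open (rbox R G).
Proof.
by move=> oG; apply: closed_openC; apply: closed_rpre => //; exact: open_closedC.
Qed.

Lemma upset_above (x : T) : upset R (R x).
Proof. by move=> y z; have [_ tR] := pR; exact: tR. Qed.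

(* Nachbin's order-normality. *)
Lemma open_upset_shrink (F V : set T) : closed F -> upset R F ->
  open V -> F `<=` V ->
  exists U, [/\ open U, upset R U, F `<=` U & closure U `<=` V].
Proof.
move=> cF uF oV FV; have [rR tR] := pR.
have nV : set_nbhs F V by apply/set_nbhsP; exists V; split.
have [D /set_nbhsP[E [oE FE ED]] DV] := compact_normal hT cT cF nV.
(* Normality provides only an open set [E]. Its part [rbox R E] is an open upset, and it still
   contains [F] because [F] is an upset. *)
exists (rbox R E); split.
- exact: open_rbox.
- move=> x y nx xy [z nEz yz]; apply: nx; exists z => //; exact: tR xy yz.
- by move=> x Fx [z nEz xz]; apply: nEz; apply: FE; exact: uF xz.
- apply: subset_trans DV; apply: closureS => x nx; apply: ED.
  by apply: contrapT => nEx; apply: nx; exists x.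
Qed.

Lemma open_upset_separation (x y : T) : ~ R x y ->
  exists U, [/\ open U, upset R U, U x & ~ closure U y].
Proof.
move=> nxy; have [rR tR] := pR.
have [|||z Rxz zy|U [oU uU xU cU]] :=
    @open_upset_shrink (R x) (~` (R^~ y)).
- exact: closed_above.
- exact: upset_above.
- by apply: closed_openC; exact: closed_below.
- by apply: nxy; exact: tR Rxz zy.
exists U; split=> // [|/cU]; first exact: xU.
by apply; exact: rR.
Qed.

End ClosedPreorder.

Lemma closed_rel_flip (T : topologicalType) (R : T -> T -> Prop) :
  closed_rel R -> closed_rel (fun x y => R y x).
Proof.
move=> cR; rewrite /closed_rel.
have -> : [set p : T * T | R p.2 p.1] =
    (fun p : T * T => (p.2, p.1)) @^-1` [set p | R p.1 p.2] by [].
apply: preimage_closed cR => z _; apply: cvg_pair; [exact: cvg_snd|exact: cvg_fst].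
Qed.

(** By compactness, [f] converges at [x] as soon as [f x] is the only cluster point of the image
    filter. A different point is not above or not below [f x], and is then kept away by an open
    upset or downset around [f x] whose closure misses it. *)
Lemma continuous_upset_downset (S T : topologicalType) (le : T -> T -> Prop)
    (f : S -> T) :
  is_compact_pospace le ->
  (forall V, open V -> upset le V -> open (f @^-1` V)) ->
  (forall V, open V -> upset (fun x y => le y x) V -> open (f @^-1` V)) ->
  continuous f.
Proof.
move=> [cT oT clT] fup fdown x.
have hT := closed_order_hausdorff oT clT; have [rle tle anti] := oT.
have pT : Relation_Definitions.preorder T le by split.
have pT' : Relation_Definitions.preorder T (fun x y => le y x).
  by split=> [//|a b c ab bc]; exact: tle bc ab.
have key (U : set T) d : open (f @^-1` U) -> U (f x) -> ~ closure U d ->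
    ~ cluster (f @ x) d.
  move=> oU Ux; apply: contra_not => cld B dB.
  by apply: cld dB; exact: (open_nbhs_nbhs (conj oU Ux)).
apply: (@compact_cluster_set1 _ _ _ setT) => //.
- exact: filterT.
- exact: filterT.
apply/seteqP; split=> [d cld|_ ->]; last first.
  move=> A B fA fB.
  exists (f x); split; first exact: (nbhs_singleton fA).
  exact: (nbhs_singleton fB).
apply: anti; apply: contrapT.
- move/(@open_upset_separation _ _ cT hT (closed_rel_flip clT) pT').
  by move=> [U [oU uU Ux nUd]]; apply: (key U d) => //; exact: fdown.
- move/(@open_upset_separation _ _ cT hT clT pT).
  by move=> [U [oU uU Ux nUd]]; apply: (key U d) => //; exact: fup.
Qed.

(** Zorn's lemma on [S] with the preorder reversed: a chain has a lower bound in [S] by compactness,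
    since the sets of elements of [S] below its members are closed and nested. *)
Lemma minimal_exists (T : topologicalType) (R : T -> T -> Prop) (S : set T) :
  compact [set: T] -> hausdorff_space T -> closed_rel R ->
  Relation_Definitions.preorder T R -> closed S -> S !=set0 ->
  exists x, minimal_in R S x.
Proof.
move=> cT hT cR [rR tR] cS [s0 Ss0].
pose Q (a b : {x | S x}) : bool := `[< R (sval b) (sval a) >].
have [| | |t tmax] := @ZL_preorder _ (exist _ s0 Ss0) Q.
- by move=> t; apply/asboolP.
- by move=> r s t /asboolP rs /asboolP st; apply/asboolP; exact: tR st rs.
- move=> A totA.
  have [[a0 Aa0]|A0] := pselect (A !=set0); last first.
    by exists (exist _ s0 Ss0) => s As; exfalso; apply: A0; exists s.
  have [||||z zA] := @compact_bigcap_neq0 T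
      [set S `&` (R^~ (sval a)) | a in A] cT.
  + by exists (S `&` (R^~ (sval a0))); exists a0.
  + move=> _ _ [a Aa <-] [b Ab <-].
    have [/asboolP ba|/asboolP ab] := totA _ _ Aa Ab.
      exists (S `&` (R^~ (sval b))); first by exists b.
      by move=> z [Sz zb]; split; split=> //; exact: tR zb ba.
    exists (S `&` (R^~ (sval a))); first by exists a.
    by move=> z [Sz zb]; split; split=> //; exact: tR zb ab.
  + by move=> _ [a Aa <-]; apply: closedI => //; exact: closed_below.
  + by move=> _ [a Aa <-]; exists (sval a); split; [exact: svalP|exact: rR].
  have Sz : S z by have [] : (S `&` (R^~ (sval a0))) z by apply: zA; exists a0.
  exists (exist _ z Sz) => s As; apply/asboolP => /=.
  by have [] : (S `&` (R^~ (sval s))) z by apply: zA; exists s.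
exists (sval t); split; first exact: svalP.
move=> y Sy yt; have /asboolP : Q (exist _ y Sy) t.
  by apply: tmax; exact/asboolP.
by [].
Qed.

(** * Ordered Gleason spaces and their quotients *)

Lemma rboxP (X Y : Type) (R : X -> Y -> Prop) (O : set Y) (x : X) :
  rbox R O x <-> forall y, R x y -> O y.
Proof.
split=> [nx y xy|H [y nOy xy]]; last by apply: nOy; exact: H.
by apply: contrapT => nOy; apply: nx; exists y.
Qed.

(** A neighbourhood of [x] cut down to the open set [closure A] meets [B]; near that point [B] is a
    neighbourhood, so it meets [A]. In an f-space this makes closure preserve binary meets of open
    upsets. *)
Lemma open_closureI (T : topologicalType) (A B : set T) :
  open B -> open (closure A) -> closure A `&` closure B `<=` closure (A `&` B).
Proof.
move=> oB oA x [Ax Bx] N; rewrite nbhsE => -[M [oM Mx] MN].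
have [|b [Bb [Mb Ab]]] := Bx (M `&` closure A).
  by apply: open_nbhs_nbhs; split; [exact: openI|].
have [|a [Aa [Ma Ba]]] := Ab (M `&` B).
  by apply: open_nbhs_nbhs; split; [exact: openI|].
by exists a; split; [split|exact: MN].
Qed.

Lemma clopup0 (T : topologicalType) (le : T -> T -> Prop) : clopup le set0.
Proof. by split; [exact: clopen0|]. Qed.

Lemma clopupT (T : topologicalType) (le : T -> T -> Prop) : clopup le setT.
Proof. by split; [exact: clopenT|]. Qed.

Lemma clopupI (T : topologicalType) (le : T -> T -> Prop) (U V : set T) :
  clopup le U -> clopup le V -> clopup le (U `&` V).
Proof.
move=> [cU uU] [cV uV]; split; first exact: clopenI.
by move=> x y [Ux Vx] xy; split; [exact: uU xy|exact: uV xy].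
Qed.

Lemma clopupU (T : topologicalType) (le : T -> T -> Prop) (U V : set T) :
  clopup le U -> clopup le V -> clopup le (U `|` V).
Proof.
move=> [cU uU] [cV uV]; split; first exact: clopenU.
by move=> x y [Ux|Vx] xy; [left; exact: uU xy|right; exact: uV xy].
Qed.

Lemma priestley_interpolation (T : topologicalType) (le : T -> T -> Prop)
    (F G : set T) :
  is_priestley le -> closed F -> open G -> upset le G -> F `<=` G ->
  exists O, [/\ clopup le O, F `<=` O & O `<=` G].
Proof.
move=> [cT _ sep]; apply: (closed_open_interpolation cT _ _ _ _ _ sep).
- by move=> O [].
- exact: clopup0.
- exact: clopupT.
- exact: clopupI.
- exact: clopupU.
Qed.

Section OrderedGleason.
Variable X : ordered_gleason.
Local Notation R := (@ogl_R X).
Local Notation le := (@ogl_le X).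

Lemma ogl_priestley : is_priestley le.
Proof. exact: fspace_priestley (ogl_fspace (ogl_axioms X)). Qed.

Lemma ogl_compact : compact [set: X].
Proof. exact: priestley_compact ogl_priestley. Qed.

Lemma ogl_hausdorff : hausdorff_space X.
Proof. exact: priestley_hausdorff ogl_priestley. Qed.

Lemma ogl_R_closed : closed_rel R.
Proof. exact: ogl_closed (ogl_axioms X). Qed.

Lemma ogl_R_preorder : Relation_Definitions.preorder X R.
Proof. exact: ogl_preorder (ogl_axioms X). Qed.

Lemma ogl_R_refl x : R x x.
Proof. by have [rR _] := ogl_R_preorder; exact: rR. Qed.

Lemma ogl_R_trans y x z : R x y -> R y z -> R x z.
Proof. by have [_ tR] := ogl_R_preorder; exact: tR. Qed.

Lemma ogl_le_refl x : le x x.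
Proof. by have [_ [rle _ _] _] := ogl_priestley; exact: rle. Qed.

Lemma ogl_le_R x y : le x y -> R x y.
Proof.
move=> xy; apply: (ogl_le_R_le (ogl_axioms X) xy (ogl_R_refl y)).
exact: ogl_le_refl.
Qed.

Lemma upset_R_le (A : set X) : upset R A -> upset le A.
Proof. by move=> uA x y Ax /ogl_le_R; exact: uA. Qed.

Lemma upset_rbox (O : set X) : upset R (rbox R O).
Proof.
move=> x y /rboxP xO xy; apply/rboxP => z yz; apply: xO.
exact: ogl_R_trans xy yz.
Qed.

Lemma rbox_sub (O : set X) : rbox R O `<=` O.
Proof. by move=> x /rboxP; apply; exact: ogl_R_refl. Qed.

Lemma open_ogl_rbox (O : set X) : open O -> open (rbox R O).
Proof. exact: open_rbox ogl_compact ogl_hausdorff ogl_R_closed _. Qed.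

Lemma ogl_interpolation (F G : set X) :
  closed F -> open G -> upset R G -> F `<=` G ->
  exists O, [/\ Clopup O, F `<=` O & O `<=` G].
Proof.
by move=> cF oG /upset_R_le uG; exact: priestley_interpolation ogl_priestley _ _ _.
Qed.

Lemma ogl_above_interpolation (x : X) (G : set X) :
  open G -> upset R G -> G x ->
  exists O, [/\ Clopup O, R x `<=` O & O `<=` G].
Proof.
move=> oG uG Gx; apply: ogl_interpolation => //; last by move=> y; exact: uG.
exact: closed_above ogl_compact ogl_hausdorff ogl_R_closed _.
Qed.

(** Interpolation between [F] and the complement of the [R]-downset of [y], which contains [F]
    because [F] is an [R]-upset missing [y]. *)
Lemma ogl_R_separation (F : set X) (y : X) :
  closed F -> upset R F -> ~ F y -> exists O, [/\ Clopup O, F `<=` O & ~ O y].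
Proof.
move=> cF uF nFy.
have [||||O [cO FO Oy]] := @ogl_interpolation F (~` (R^~ y)).
- exact: cF.
- apply: closed_openC.
  exact: closed_below ogl_compact ogl_hausdorff ogl_R_closed _.
- by move=> a b nay ab nby; apply: nay; exact: ogl_R_trans ab nby.
- by move=> z Fz zy; apply: nFy; exact: uF zy.
by exists O; split=> // /Oy; apply; exact: ogl_R_refl.
Qed.

Lemma ogl_le_clopup (x y : X) :
  (forall O : set X, Clopup O -> O x -> O y) -> le x y.
Proof.
move=> H; apply: contrapT => nxy.
have [_ _ sep] := ogl_priestley; have [O [cO Ox nOy]] := sep _ _ nxy.
by apply: nOy; exact: H cO Ox.
Qed.

Lemma clopup_closure (V : set X) : open V -> upset R V -> Clopup (closure V).
Proof.
move=> oV /upset_R_le uV.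
have [oC uC] := fspace_closure (ogl_fspace (ogl_axioms X)) oV uV.
by split=> //; split=> //; exact: closed_closure.
Qed.

Lemma xi_hausdorff : hausdorff_space (xi_obj X).
Proof.
have [_ oX cX] := ogl_quot_pospace X.
exact: closed_order_hausdorff oX cX.
Qed.

Lemma closed_class_image (A : set X) :
  closed A -> closed (@ogl_class X @` A : set (xi_obj X)).
Proof.
move=> cA; apply: (compact_closed xi_hausdorff); apply: continuous_compact.
  by apply: continuous_subspaceT => x; exact: ogl_class_continuous.
exact: subclosed_compact cA ogl_compact _.
Qed.

Lemma ogl_quot_le_refl (a : ogl_quot X) : ogl_quot_le a a.
Proof. by have [_ [r _ _] _] := ogl_quot_pospace X; exact: r. Qed.

Lemma ogl_quot_le_trans (b a c : ogl_quot X) :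
  ogl_quot_le a b -> ogl_quot_le b c -> ogl_quot_le a c.
Proof. by have [_ [_ t _] _] := ogl_quot_pospace X; exact: t. Qed.

(** This is [pi(#O)], expressed through the order of the quotient so that no representative is
    chosen. *)
Definition quot_box (O : set X) : set (xi_obj X) :=
  [set c | forall y, ogl_quot_le c (ogl_class y) -> O y].

Lemma quot_box_class (O : set X) (x : X) :
  quot_box O (ogl_class x) <-> rbox R O x.
Proof.
split=> [H|/rboxP H y /ogl_quot_leE]; last exact: H.
by apply/rboxP => y /ogl_quot_leE; exact: H.
Qed.

Lemma open_quot_box (O : set X) : open O -> open (quot_box O).
Proof.
move=> oO; apply: ogl_quot_open.
suff -> : ogl_class (X:=X) @^-1` quot_box O = rbox R O by exact: open_ogl_rbox.
by apply/seteqP; split=> x /quot_box_class.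
Qed.

Lemma upset_quot_box (O : set X) : upset (@ogl_quot_le X) (quot_box O).
Proof. by move=> a b Oa ab y yb; apply: Oa; exact: ogl_quot_le_trans ab yb. Qed.

End OrderedGleason.

Arguments ogl_R_trans {X} y.
Arguments ogl_quot_le_trans {X} b.

(** * The relation associated with a continuous monotone map *)

Section RelOfMap.
Variables X Y : ordered_gleason.
Variable f : xi_obj X -> xi_obj Y.

Definition box_preimage (O : set Y) : set X :=
  [set x | quot_box O (f (ogl_class x))].

(* [closure (box_preimage O)] is the value at [O] of the meet-preserving map
   associated to the relation, see [rbox_rel_of_map]. *)
Definition rel_of_map (x : X) (y : Y) : Prop :=
  forall O, Clopup O -> closure (box_preimage O) x -> O y.

Hypothesis fP : is_kps_morphism f.
Local Notation h := (fun O : set Y => closure (box_preimage O)).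

Lemma open_box_preimage O : Clopup O -> open (box_preimage O).
Proof.
move=> [[oO _] _]; have [cf _] := fP.
have /continuousP : continuous (f \o ogl_class (X:=X)).
  move=> x; apply: continuous_comp; [exact: ogl_class_continuous|exact: cf].
by apply; exact: open_quot_box.
Qed.

Lemma upset_box_preimage O : upset (@ogl_R X) (box_preimage O).
Proof.
move=> x y Ox /ogl_quot_leE xy; have [_ mf] := fP.
exact: upset_quot_box Ox (mf _ _ xy).
Qed.

Lemma clopup_closure_box O : Clopup O -> Clopup (h O).
Proof.
by move=> cO; apply: clopup_closure; [exact: open_box_preimage|exact: upset_box_preimage].
Qed.

Lemma closure_boxS O U : O `<=` U -> h O `<=` h U.
Proof. by move=> OU; apply: closureS => x Ox y /Ox; exact: OU. Qed.

Lemma closure_boxI O U : Clopup O -> Clopup U -> h O `&` h U `<=` h (O `&` U).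
Proof.
move=> cO cU; have [[oO _] _] := clopup_closure_box cO.
apply: subset_trans (open_closureI (open_box_preimage cU) oO) _.
by apply: closureS => x [Ox Ux] y xy; split; [exact: Ox|exact: Ux].
Qed.

(** The image of [O] in the quotient is closed, being compact in a Hausdorff space, so its preimage
    contains the closure of [box_preimage f O] along with that set. *)
Lemma closure_box_image O x : Clopup O -> h O x ->
  exists2 y, O y & f (ogl_class x) = ogl_class y.
Proof.
move=> [[_ cO] _] hx; have [cf _] := fP.
suff : (@ogl_class Y @` O) (f (ogl_class x)) by move=> [y Oy <-]; exists y.
have cI : closed ((f \o ogl_class (X:=X)) @^-1` (@ogl_class Y @` O)).
  apply: preimage_closed (closed_class_image cO) => z _.
  apply: continuous_comp; [exact: ogl_class_continuous|exact: cf].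
suff : closure ((f \o ogl_class (X:=X)) @^-1` (@ogl_class Y @` O)) x.
  by rewrite -(closure_id _).1.
apply: closureS hx => z Oz /=.
have [y E] := ogl_class_surj (f (ogl_class z)).
exists y => //; apply: Oz; rewrite E; exact: ogl_quot_le_refl.
Qed.

(** The relation at [x] is the intersection of all [U] with [x] in [h U]. These [U] are directed
    since [h] preserves meets, so compactness turns the pointwise condition on [C] into a common
    point. *)
Lemma rel_of_map_meets (C : set Y) x : closed C ->
  (forall U, Clopup U -> h U x -> U `&` C !=set0) ->
  exists2 y, C y & rel_of_map x y.
Proof.
move=> cC H.
have hT : h setT x by exact: subset_closure.
have [||||y yP] := @compact_bigcap_neq0 Y
    [set U `&` C | U in [set U | Clopup U /\ h U x]] (@ogl_compact Y).
- by exists (setT `&` C); exists setT => //; split=> //; exact: clopupT.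
- move=> _ _ [U [cU Ux] <-] [V [cV Vx] <-]; exists ((U `&` V) `&` C).
    exists (U `&` V) => //; split; first exact: clopupI.
    exact: closure_boxI.
  by move=> z [[Uz Vz] Cz].
- by move=> _ [U [[[_ cU] _] _] <-]; exact: closedI.
- by move=> _ [U [cU Ux] <-]; exact: H.
exists y; last by move=> O cO Ox; have [] : (O `&` C) y by apply: yP; exists O.
have [] // : (setT `&` C) y.
by apply: yP; exists setT => //; split=> //; exact: clopupT.
Qed.

(** If [x] is outside [h O], monotonicity of [h] shows that every [U] with [x] in [h U] leaves [O];
    then [x] is related to a point of the complement of [O]. *)
Lemma rbox_rel_of_map O : Clopup O -> rbox rel_of_map O = h O.
Proof.
move=> cO; apply/seteqP; split=> [x /rboxP xO|x hx]; last first.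
  by apply/rboxP => y; apply.
apply: contrapT => nhx.
have [||y nOy /xO //] := @rel_of_map_meets (~` O) x.
  by have [[oO _] _] := cO; exact: open_closedC.
move=> U cU hU; apply: contrapT => E; apply: nhx; apply: closure_boxS hU.
by move=> z Uz; apply: contrapT => nOz; apply: E; exists z.
Qed.

(** With [z] in the class [f (ogl_class x)], a clopen upset containing everything [R]-above [z] but
    missing [y] would have [x] in its [h], hence would contain [y]. *)
Lemma rel_of_map_le x y : rel_of_map x y ->
  ogl_quot_le (f (ogl_class x)) (ogl_class y).
Proof.
move=> xy; have [z E] := ogl_class_surj (f (ogl_class x)).
rewrite E; apply/ogl_quot_leE; apply: contrapT => nzy.
have [|||O [cO zO nOy]] := @ogl_R_separation _ (@ogl_R Y z) y.
- exact: closed_above (@ogl_compact Y) (@ogl_hausdorff Y) (@ogl_R_closed Y) _.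
- by move=> a b za ab; exact: ogl_R_trans za ab.
- by [].
apply: nOy; apply: xy cO _; apply: subset_closure => w.
by rewrite E => /ogl_quot_leE; exact: zO.
Qed.

(** Together with [rel_of_map_le] this makes [f (ogl_class x)] the least class related to [x]. The
    point is found in the closed downset of a representative [z], which every [U] with [x] in [h U]
    meets by [closure_box_image]. *)
Lemma rel_of_map_attained x :
  exists2 y, f (ogl_class x) = ogl_class y & rel_of_map x y.
Proof.
have [z E] := ogl_class_surj (f (ogl_class x)).
have [||y yz xy] := @rel_of_map_meets ((@ogl_R Y)^~ z) x.
- exact: closed_below (@ogl_compact Y) (@ogl_hausdorff Y) (@ogl_R_closed Y) _.
- move=> U cU /(closure_box_image cU)[y Uy]; rewrite E => /ogl_classP[zy yz].
  by exists y; split.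
exists y => //; rewrite E; apply/ogl_classP; split=> //.
by have := rel_of_map_le xy; rewrite E => /ogl_quot_leE.
Qed.

Lemma minimal_rel_of_map x y :
  minimal_in (@ogl_R Y) (rel_of_map x) y -> f (ogl_class x) = ogl_class y.
Proof.
move=> [xy ymin]; have [z E xz] := rel_of_map_attained x.
have zy : ogl_R z y by have := rel_of_map_le xy; rewrite E => /ogl_quot_leE.
by rewrite E; apply/ogl_classP; split=> //; exact: ymin.
Qed.

Lemma rel_of_map_induces : induces rel_of_map f.
Proof.
move=> x; split; last by move=> y; exact: minimal_rel_of_map.
have [y E xy] := rel_of_map_attained x; exists y; split=> // z xz _.
by have := rel_of_map_le xz; rewrite E => /ogl_quot_leE.
Qed.

Lemma rel_of_map_morphism : is_ogl_morphism rel_of_map.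
Proof.
split; first split.
- move=> x1 x2 y1 y2 x12 xy y12 O cO Ox1.
  have [_ uO] := cO; apply: uO y12; apply: (xy _ cO).
  by have [_ uh] := clopup_closure_box cO; exact: uh x12.
- rewrite /closed_rel -openC openE => -[x y] /= nxy.
  have [O [cO Ox nOy]] : exists O, [/\ Clopup O, h O x & ~ O y].
    apply: contrapT => E; apply: nxy => O cO Ox; apply: contrapT => nOy.
    by apply: E; exists O.
  have [[oh _] _] := clopup_closure_box cO; have [[_ clO] _] := cO.
  exists (h O, ~` O).
    split; apply: open_nbhs_nbhs; split=> //; exact: closed_openC.
  by move=> [u v] [/= Ou nOv] uv; apply: nOv; exact: uv Ou.
- by move=> O cO; rewrite rbox_rel_of_map //; exact: clopup_closure_box.
- by move=> x; have [y _ xy] := rel_of_map_attained x; exists y.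
- move=> x1 x2 y1 y2 /minimal_rel_of_map E _ x12 /rel_of_map_le xy.
  apply/ogl_quot_leE; rewrite -E; apply: ogl_quot_le_trans xy.
  by have [_ mf] := fP; apply: mf; exact/ogl_quot_leE.
(* After complementation the de Vries condition reads [h O = closure (rbox rho (rbox R O))] with
   [rho] the relation of [f]. It holds because that inner set lies between [box_preimage f O] and
   [h O]. *)
- move=> O cO; apply: setC_inj; rewrite -closure_setC -/(rbox _ _).
  have -> : ~` rpre rel_of_map (rpre (@ogl_R Y) (~` O)) =
      rbox rel_of_map (rbox (@ogl_R Y) O) by rewrite /rbox setCK.
  rewrite rbox_rel_of_map //; apply/seteqP; split.
    apply: closureS => x Ox; apply/rboxP => y /rel_of_map_le.
    by move=> xy; apply/quot_box_class; exact: upset_quot_box Ox xy.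
  have /closure_id -> := @closed_closure _ (box_preimage O).
  apply: closureS => x /rboxP H; rewrite -rbox_rel_of_map //.
  by apply/rboxP => y /H; exact: rbox_sub.
Qed.

End RelOfMap.

(** * The map induced by a morphism *)

Section MapOfRel.
Variables X Y : ordered_gleason.
Variable rho : X -> Y -> Prop.
Hypothesis rhoP : is_ogl_morphism rho.

Lemma morphism_closed_img x : closed (rho x).
Proof.
have [[_ cr _ _] _ _] := rhoP.
have -> : rho x = (fun y => (x, y)) @^-1` [set p : X * Y | rho p.1 p.2] by [].
by apply: preimage_closed cr => z _; apply: cvg_pair; [exact: cvg_cst|exact: cvg_id].
Qed.

Lemma morphism_minimal_exists x : exists y, minimal_in (@ogl_R Y) (rho x) y.
Proof.
have [[_ _ _ ne] _ _] := rhoP.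
exact: minimal_exists (@ogl_compact Y) (@ogl_hausdorff Y) (@ogl_R_closed Y)
  (@ogl_R_preorder Y) (@morphism_closed_img x) (ne x).
Qed.

Lemma morphism_minimal_le x1 x2 y1 y2 :
  minimal_in (@ogl_R Y) (rho x1) y1 -> ogl_R x1 x2 -> rho x2 y2 -> ogl_R y1 y2.
Proof. by have [_ ofc _] := rhoP; move=> m; apply: ofc => //; case: m. Qed.

(** [rho x] is a closed upset. If [y] is outside it, the clopen upsets missing [y] cover it, and
    interpolation inside their union gives a single one containing [rho x]. *)
Lemma morphism_rel_rbox x y :
  rho x y <-> forall O, Clopup O -> rbox rho O x -> O y.
Proof.
split=> [xy O _ /rboxP|H]; first exact.
apply: contrapT => nxy; have [[le_r _ _ _] _ _] := rhoP.
have [_ [rle tle _] sep] := ogl_priestley Y.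
have [O [cO FO nOy]] : exists O, [/\ Clopup O, rho x `<=` O & ~ O y].
  have [| | |B [cB FB BG]] := @priestley_interpolation Y (@ogl_le Y) (rho x)
    (\bigcup_(O in [set O | Clopup O /\ ~ O y]) O) (ogl_priestley Y)
    (@morphism_closed_img x).
  - by apply: bigcup_open => O [[[]]].
  - by move=> a b [O [cO nOy] Oa] ab; exists O => //; have [_ uO] := cO; exact: uO ab.
  - move=> z xz; have [|O [cO Oz nOy]] := sep z y; last by exists O.
    by move=> zy; apply: nxy; exact: le_r (ogl_le_refl x) xz zy.
  exists B; split=> // /BG[O [_ nOy] Oy]; exact: nOy.
by apply: nOy; apply: H => //; exact/rboxP.
Qed.

Lemma rbox_de_vries O : Clopup O ->
  rbox rho O = closure (rbox rho (rbox (@ogl_R Y) O)).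
Proof.
have [_ _ dv] := rhoP.
by move=> cO; rewrite {1}/rbox dv // -closure_setC {1}/rbox /rbox setCK.
Qed.

Variable f : xi_obj X -> xi_obj Y.
Hypothesis rhof : induces rho f.

Lemma induces_attained x : exists2 y, f (ogl_class x) = ogl_class y & rho x y.
Proof.
have [[y ymin] H] := rhof x; exists y; first exact: H.
by case: ymin.
Qed.

Lemma induces_le x y : rho x y -> ogl_quot_le (f (ogl_class x)) (ogl_class y).
Proof.
have [[z zmin] H] := rhof x; rewrite (H _ zmin) => xy; apply/ogl_quot_leE.
by apply: morphism_minimal_le zmin _ xy; exact: ogl_R_refl.
Qed.

(** The class [f (ogl_class x)] is attained in [rho x] and lies below everything there, so it alone
    decides whether [rho x] is inside an [R]-upset. *)
Lemma rbox_induced (A : set Y) : upset (@ogl_R Y) A ->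
  forall x y, f (ogl_class x) = ogl_class y -> rbox rho A x <-> A y.
Proof.
move=> uA x y E; split=> [/rboxP xA|Ay].
  have [z] := induces_attained x; rewrite E => /ogl_classP[_ zy] /xA Az.
  exact: uA zy.
apply/rboxP => z /induces_le; rewrite E => /ogl_quot_leE; exact: uA.
Qed.

Lemma rbox_induces O : Clopup O -> rbox rho O = closure (box_preimage f O).
Proof.
move=> cO; rewrite rbox_de_vries //; congr closure; apply/predeqP => x.
have [y E] := ogl_class_surj (f (ogl_class x)).
apply: (iff_trans (rbox_induced (@upset_rbox Y O) E)).
by rewrite /box_preimage /= E; apply: iff_sym; exact: quot_box_class.
Qed.

Lemma rel_of_map_induced : rel_of_map f = rho.
Proof.
apply/funext => x; apply/funext => y; apply/propext.
split=> [H|/morphism_rel_rbox H O cO].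
  by apply/morphism_rel_rbox => O cO; rewrite rbox_induces //; exact: H.
by rewrite -rbox_induces //; exact: H.
Qed.

Lemma induces_kps_morphism : is_kps_morphism f.
Proof.
split; last first.
  move=> a b; have [x ->] := ogl_class_surj a; have [y ->] := ogl_class_surj b.
  move/ogl_quot_leE => xy; have [[x' xmin] Hx] := rhof x.
  have [y' -> yy'] := induces_attained y; rewrite (Hx _ xmin).
  by apply/ogl_quot_leE; exact: morphism_minimal_le xmin xy yy'.
have [_ _ cl_rho _] : is_strong_meet_hemirelation rho by have [] := rhoP.
apply: continuous_upset_downset (ogl_quot_pospace Y) _ _ => V oV uV.
  apply: ogl_quot_open; pose V' := @ogl_class Y @^-1` V.
  have oV' : open V'.
    by have /continuousP := @ogl_class_continuous Y; apply.
  have uV' : upset (@ogl_R Y) V' by move=> a b Va /ogl_quot_leE; exact: uV.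
  (* Interpolation above a representative of [f (ogl_class x)] provides an [O] inside [V'], and each
     [rbox rho O] is open. *)
  suff -> : ogl_class (X:=X) @^-1` (f @^-1` V) =
      \bigcup_(O in [set O | Clopup O /\ O `<=` V']) rbox rho O.
    by apply: bigcup_open => O [/cl_rho[[]]].
  apply/seteqP; split=> x /=; have [y E] := ogl_class_surj (f (ogl_class x)).
    rewrite E => Vy; have [O [cO yO OV]] := ogl_above_interpolation oV' uV' Vy.
    exists O; first by split.
    by apply/rboxP => z /induces_le; rewrite E => /ogl_quot_leE; exact: yO.
  move=> [O [cO OV] /rboxP xO]; have [z -> xz] := induces_attained x.
  by apply: OV; exact: xO.
apply: ogl_quot_open; pose F := ~` (@ogl_class Y @^-1` V).
have cF : closed F.
  by apply: open_closedC; have /continuousP := @ogl_class_continuous Y; apply.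
have uF : upset (@ogl_R Y) F.
  by move=> a b nVa /ogl_quot_leE ab Vb; apply: nVa; exact: uV ab.
(* Dually for a downset: the closed [R]-upset [F] is separated from a related point in the least
   class, and each [rbox rho O] is closed. *)
suff -> : ogl_class (X:=X) @^-1` (f @^-1` V) =
    \bigcup_(O in [set O | Clopup O /\ F `<=` O]) ~` rbox rho O.
  by apply: bigcup_open => O [/cl_rho[[_ cO] _] _]; exact: closed_openC.
apply/seteqP; split=> x /=; have [y E xy] := induces_attained x; rewrite E.
  move=> Vy; have [|O [cO FO nOy]] := ogl_R_separation cF uF (_ : ~ F y).
    by apply.
  by exists O => // /rboxP /(_ _ xy).
move=> [O [cO FO] nxO]; apply: contrapT => nVy; apply: nxO; apply/rboxP => z.
by move=> /induces_le; rewrite E => /ogl_quot_leE yz; apply: FO; exact: uF yz.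
Qed.

End MapOfRel.

Lemma morphism_induces_exists (X Y : ordered_gleason) (rho : X -> Y -> Prop) :
  is_ogl_morphism rho -> exists f : xi_obj X -> xi_obj Y, induces rho f.
Proof.
move=> rhoP; have [m mP] := choice (morphism_minimal_exists rhoP).
have cs (a : ogl_quot X) : exists x, a = ogl_class x by exact: ogl_class_surj.
(* The value uses a chosen representative. The ordered forth condition, applied both ways between
   equivalent points, shows that their minimal points are equivalent. *)
exists (fun a => ogl_class (m (sval (cid (cs a))))) => x.
split; first by exists (m x).
case: cid => z /= /ogl_classP[xz zx] y ymin; apply/ogl_classP; split.
  by apply: (morphism_minimal_le rhoP (mP z) zx); case: ymin.
by apply: (morphism_minimal_le rhoP ymin xz); case: (mP z).
Qed.

Lemma induces_inj (X Y : ordered_gleason) (rho : X -> Y -> Prop)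
    (f g : xi_obj X -> xi_obj Y) : induces rho f -> induces rho g -> f = g.
Proof.
move=> rf rg; apply/funext => a; have [x ->] := ogl_class_surj a.
have [[y ymin] Hf] := rf x; have [_ Hg] := rg x.
by rewrite (Hf _ ymin) (Hg _ ymin).
Qed.

(** The axiom [O = cl #O] says that the map [h] of the identity fixes every clopen upset, and clopen
    upsets determine the order of a Priestley space. *)
Lemma rel_of_map_id (X : ordered_gleason) :
  @rel_of_map X X id = @ogl_le X.
Proof.
apply/funext => x; apply/funext => y; apply/propext.
have E O : Clopup O -> closure (@box_preimage X X id O) = O.
  move=> cO; rewrite [RHS](ogl_dense (ogl_axioms X) cO); congr closure.
  by apply/seteqP; split=> z /quot_box_class.
split=> [H|xy O cO].
  by apply: ogl_le_clopup => O cO Ox; apply: H => //; rewrite E.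
by rewrite E // => Ox; have [_ uO] := cO; exact: uO xy.
Qed.

(** * Composition of relations and the category laws *)

Section Star.
Variables X Y Z : ordered_gleason.
Variables (g : xi_obj Y -> xi_obj Z) (f : xi_obj X -> xi_obj Y).
Hypotheses (gP : is_kps_morphism g) (fP : is_kps_morphism f).

Lemma star_map_rel_of_map O : Clopup O ->
  star_map (rel_of_map g) (rel_of_map f) O = closure (box_preimage (g \o f) O).
Proof.
move=> cO.
have hE U : Clopup U -> rbox (rel_of_map f) (rbox (rel_of_map g) U) =
    closure (box_preimage f (closure (box_preimage g U))).
  by move=> cU; rewrite rbox_rel_of_map // rbox_rel_of_map //; exact: clopup_closure_box.
rewrite /star_map clopup_joinE; last 2 first.
- exact: ogl_fspace (ogl_axioms X).
- move=> _ [U [cU _] <-]; rewrite hE //; apply: clopup_closure_box => //.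
  exact: clopup_closure_box.
apply/seteqP; split.
  (* If [x] is in the inner box for [U], then [g (f (ogl_class x))] is the class of a point of [U],
     and [U] being below [O] for the proximity puts everything above that class in [O]. *)
  have /closure_id -> := @closed_closure _ (box_preimage (g \o f) O).
  apply: closureS => x [_ [U [cU UO] <-]]; rewrite hE //; apply: closureS => {}x.
  rewrite /box_preimage /=; have [y ->] := ogl_class_surj (f (ogl_class x)).
  move=> /quot_box_class /rbox_sub /(closure_box_image gP cU)[z Uz ->].
  by apply/quot_box_class/rboxP => w zw; apply: UO; exists z.
apply: closureS => x; rewrite /box_preimage /=.
have [y E] := ogl_class_surj (f (ogl_class x)).
have [z E'] := ogl_class_surj (g (ogl_class y)).
rewrite E E' => /quot_box_class Oz; have [[oO _] _] := cO.
(* Interpolating below the open upset [#O], rather than below [O], gives a [U] with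
   [ogl_prec U O]. *)
have [U [cU zU UO]] :=
  ogl_above_interpolation (open_ogl_rbox oO) (@upset_rbox Z O) Oz.
exists (rbox (rel_of_map f) (rbox (rel_of_map g) U)).
  exists U => //; split=> // w [u /UO /rboxP]; exact.
rewrite hE //; apply: subset_closure => w; rewrite E => yw.
apply: subset_closure; apply: upset_quot_box (proj2 gP _ _ yw).
by rewrite E'; apply/quot_box_class/rboxP.
Qed.

Lemma star_rel_of_map :
  star (rel_of_map g) (rel_of_map f) = rel_of_map (g \o f).
Proof.
apply/funext => x; apply/funext => z; apply/propext.
split=> H O cO; have := H O cO; first by rewrite star_map_rel_of_map.
by rewrite star_map_rel_of_map.
Qed.

End Star.

Lemma morphism_rel_of_map (X Y : ordered_gleason) (rho : X -> Y -> Prop) :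
  is_ogl_morphism rho ->
  exists f : xi_obj X -> xi_obj Y, is_kps_morphism f /\ rho = rel_of_map f.
Proof.
move=> rhoP; have [f rf] := morphism_induces_exists rhoP.
by exists f; split; [exact: induces_kps_morphism rf|rewrite (rel_of_map_induced rhoP rf)].
Qed.

Lemma kps_morphism_id (P : compact_pospace) : @is_kps_morphism P P id.
Proof. exact: kps_id_subproof. Qed.

Lemma kps_morphism_comp (P Q S : compact_pospace) (g : Q -> S) (f : P -> Q) :
  is_kps_morphism g -> is_kps_morphism f -> is_kps_morphism (g \o f).
Proof. by move=> gP fP; exact: (kps_comp_subproof (exist _ g gP) (exist _ f fP)). Qed.

Lemma ogl_laws : OGlSp_laws.
Proof.
have idP (X : ordered_gleason) : is_ogl_morphism (@ogl_le X).
  rewrite -rel_of_map_id; apply: rel_of_map_morphism; exact: kps_morphism_id.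
have starE (X Y Z : ordered_gleason) (g : xi_obj Y -> xi_obj Z)
    (f : xi_obj X -> xi_obj Y) : is_kps_morphism g -> is_kps_morphism f ->
  star (rel_of_map g) (rel_of_map f) = rel_of_map (g \o f).
  exact: star_rel_of_map.
split=> //.
- move=> X Y Z r1 r2 /morphism_rel_of_map[g [gP ->]] /morphism_rel_of_map[f [fP ->]].
  by rewrite starE //; apply: rel_of_map_morphism; exact: kps_morphism_comp.
- move=> X Y r /morphism_rel_of_map[f [fP ->]].
  by rewrite -rel_of_map_id starE //; exact: kps_morphism_id.
- move=> X Y r /morphism_rel_of_map[f [fP ->]].
  by rewrite -rel_of_map_id starE //; exact: kps_morphism_id.
- move=> X Y Z T r1 r2 r3 /morphism_rel_of_map[f1 [f1P ->]].
  move=> /morphism_rel_of_map[f2 [f2P ->]] /morphism_rel_of_map[f3 [f3P ->]].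
  by rewrite !starE //; exact: kps_morphism_comp.
Qed.

(** * The ordered Gleason cover of a compact pospace *)

Section PrimeFilters.
Variable P : compact_pospace.
Local Notation le := (@kps_le P).

Definition open_up : set (set P) := [set U | open U /\ upset le U].

Lemma open_up0 : open_up set0.
Proof. by split; [exact: open0|]. Qed.

Lemma open_upT : open_up setT.
Proof. by split; [exact: openT|]. Qed.

Lemma open_upI U V : open_up U -> open_up V -> open_up (U `&` V).
Proof.
move=> [oU uU] [oV uV]; split; first exact: openI.
by move=> x y [Ux Vx] xy; split; [exact: uU xy|exact: uV xy].
Qed.

Lemma open_upU U V : open_up U -> open_up V -> open_up (U `|` V).
Proof.
move=> [oU uU] [oV uV]; split; first exact: openU.
by move=> x y [Ux|Vx] xy; [left; exact: uU xy|right; exact: uV xy].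
Qed.

Lemma open_up_bigcup (D : set (set P)) : D `<=` open_up ->
  open_up (\bigcup_(U in D) U).
Proof.
move=> DU; split; first by apply: bigcup_open => U /DU[].
move=> x y [U /[dup] DV /DU[_ uU] Ux] xy; exists U => //; exact: uU xy.
Qed.

Record is_prime_filter (x : set (set P)) : Prop := IsPrimeFilter {
  prime_filter_open : x `<=` open_up;
  prime_filterT : x setT;
  prime_filter0 : ~ x set0;
  prime_filterI : forall U V, x U -> x V -> x (U `&` V);
  prime_filterS : forall U V, open_up V -> U `<=` V -> x U -> x V;
  prime_filterU : forall U V, open_up U -> open_up V -> x (U `|` V) ->
    x U \/ x V }.

Record prime_filter := PrimeFilter {
  prime_filter_mem :> set P -> Prop;
  prime_filterP : is_prime_filter prime_filter_mem }.

Lemma prime_filter_inj (x y : prime_filter) :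
  prime_filter_mem x = prime_filter_mem y -> x = y.
Proof.
case: x y => [x px] [y py] /= E; move: px py; rewrite E => px py.
by rewrite (Prop_irrelevance px py).
Qed.

(** The Priestley topology. One pair [A], [B] is enough for a basic neighbourhood, since
    intersections and primeness merge finitely many conditions. *)
Definition prime_filter_nbhs (x : prime_filter) : set_system prime_filter :=
  [set N | exists A B, [/\ x A, open_up B, ~ x B &
    forall y : prime_filter, y A -> ~ y B -> N y]].

Lemma prime_filter_nbhs_filter x : ProperFilter (prime_filter_nbhs x).
Proof.
have Px := prime_filterP x; split.
  by move=> [A [B [xA _ nxB]]] /(_ x xA nxB).
split.
- exists setT, set0; split => //; [exact: prime_filterT|exact: open_up0|].
  exact: prime_filter0.
- move=> M N [A [B [xA oB nxB ABM]]] [A' [B' [xA' oB' nxB' ABN]]].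
  exists (A `&` A'), (B `|` B'); split.
  + exact: prime_filterI.
  + exact: open_upU.
  + by move=> /(prime_filterU Px oB oB')[].
  + move=> y yA nyB; have Py := prime_filterP y.
    have oA := prime_filter_open Px xA; have oA' := prime_filter_open Px xA'.
    split; [apply: ABM|apply: ABN].
    * by apply: (prime_filterS Py oA _ yA) => z [].
    * apply: contra_not nyB; apply: (prime_filterS Py); first exact: open_upU.
      by move=> z; left.
    * by apply: (prime_filterS Py oA' _ yA) => z [].
    * apply: contra_not nyB; apply: (prime_filterS Py); first exact: open_upU.
      by move=> z; right.
- move=> M N MN [A [B [xA oB nxB ABM]]]; exists A, B; split=> // y yA nyB.
  exact/MN/ABM.
Qed.

Lemma prime_filter_nbhs_singleton x N : prime_filter_nbhs x N -> N x.
Proof. by move=> [A [B [xA _ nxB]]]; apply. Qed.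

Lemma prime_filter_nbhs_nbhs x N :
  prime_filter_nbhs x N -> prime_filter_nbhs x (prime_filter_nbhs^~ N).
Proof.
move=> [A [B [xA oB nxB ABN]]]; exists A, B; split=> // y yA nyB.
by exists A, B.
Qed.

HB.instance Definition _ := gen_eqMixin prime_filter.
HB.instance Definition _ := gen_choiceMixin prime_filter.
HB.instance Definition _ := hasNbhs.Build prime_filter prime_filter_nbhs.
HB.instance Definition _ := Nbhs_isNbhsTopological.Build prime_filter
  prime_filter_nbhs_filter prime_filter_nbhs_singleton prime_filter_nbhs_nbhs.

Definition prime_filter_le (x y : prime_filter) : Prop :=
  forall U, x U -> y U.

Definition stone_set (U : set P) : set prime_filter := [set x | x U].

Lemma nbhs_prime_filterE (x : prime_filter) (N : set prime_filter) :
  nbhs x N <-> exists A B, [/\ x A, open_up B, ~ x B &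
    forall y : prime_filter, y A -> ~ y B -> N y].
Proof. by []. Qed.

Lemma clopup_stone_set U : open_up U -> clopup prime_filter_le (stone_set U).
Proof.
move=> oU; split; last by move=> x y xU; exact.
split.
  rewrite openE => x xU; apply/nbhs_prime_filterE; exists U, set0; split=> //.
    exact: open_up0.
  exact: prime_filter0 (prime_filterP x).
rewrite -openC openE => x nxU; apply/nbhs_prime_filterE; exists setT, U.
by split=> //; exact: prime_filterT (prime_filterP x).
Qed.

(** An ultrafilter converges to the set of those [U] whose [stone_set U] it contains; this filter is
    prime because an ultrafilter decides each [stone_set U]. *)
Lemma prime_filter_compact : compact [set: prime_filter].
Proof.
rewrite compact_ultra => F FU _.
have PF : ProperFilter F by exact: ultra_proper.
pose x : set (set P) := [set U | open_up U /\ F (stone_set U)].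
have Px : is_prime_filter x.
  split.
  - by move=> U [].
  - split; first exact: open_upT.
    by apply: filterS filterT => y _; exact: prime_filterT (prime_filterP y).
  - move=> [_ /filter_ex[y]]; exact: prime_filter0 (prime_filterP y).
  - move=> U V [oU FU1] [oV FV]; split; first exact: open_upI.
    apply: filterS (filterI FU1 FV) => y [yU yV].
    exact: prime_filterI (prime_filterP y) _ _ yU yV.
  - move=> U V oV UV [oU FU1]; split=> //; apply: filterS FU1 => y.
    exact: prime_filterS (prime_filterP y) _ _ oV UV.
  - move=> U V oU oV [_ FUV].
    have [FU1|FnU] := in_ultra_setVsetC (stone_set U) FU; first by left.
    right; split=> //; apply: filterS (filterI FUV FnU) => y [yUV nyU].
    by have [] := prime_filterU (prime_filterP y) oU oV yUV.
exists (PrimeFilter Px); split=> // N /nbhs_prime_filterE[A [B [[oA FA] oB nxB ABN]]].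
have FnB : F (~` stone_set B).
  by have [FB|//] := in_ultra_setVsetC (stone_set B) FU; case: nxB.
by apply: filterS (filterI FA FnB) => y [yA nyB]; exact: ABN.
Qed.

Lemma prime_filter_order : Relation_Definitions.order prime_filter prime_filter_le.
Proof.
split=> [x U|x y z xy yz U /xy /yz|x y xy yx] //.
by apply: prime_filter_inj; apply/seteqP.
Qed.

(** With [F = G] this says that each clopen upset is a [stone_set U]. *)
Lemma stone_set_interpolation (F G : set prime_filter) :
  closed F -> open G -> upset prime_filter_le G -> F `<=` G ->
  exists U, [/\ open_up U, F `<=` stone_set U & stone_set U `<=` G].
Proof.
move=> cF oG uG FG.
have [||||||O [[U oU <-] FU UG]] := closed_open_interpolation
  prime_filter_compact (_ : stone_set @` open_up `<=` clopen)
  _ _ _ _ _ cF oG uG FG; last by exists U.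
- by move=> _ [U oU <-]; have [] := clopup_stone_set oU.
- exists set0; first exact: open_up0.
  by apply/seteqP; split=> // x; exact: prime_filter0 (prime_filterP x).
- exists setT; first exact: open_upT.
  by apply/seteqP; split=> // x _; exact: prime_filterT (prime_filterP x).
- move=> _ _ [U oU <-] [V oV <-]; exists (U `&` V); first exact: open_upI.
  apply/seteqP; split=> x /=; have Px := prime_filterP x.
    by move=> xUV; split; apply: (prime_filterS Px _ _ xUV) => // z [].
  by move=> [xU xV]; exact: prime_filterI.
- move=> _ _ [U oU <-] [V oV <-]; exists (U `|` V); first exact: open_upU.
  apply/seteqP; split=> x /=; have Px := prime_filterP x.
    exact: prime_filterU.
  by move=> [xU|xV]; apply: (prime_filterS Px (open_upU oU oV) _ _);
    [|exact: xU| |exact: xV] => z; [left|right].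
- move=> x y nxy; have [U xU nyU] : exists2 U, x U & ~ y U.
    apply: contrapT => E; apply: nxy => U xU; apply: contrapT => nyU.
    by apply: E; exists U.
  exists (stone_set U); split=> //; exists U => //.
  exact: prime_filter_open (prime_filterP x) _ xU.
Qed.

Lemma prime_filter_priestley : is_priestley prime_filter_le.
Proof.
split; [exact: prime_filter_compact|exact: prime_filter_order|].
move=> x y nxy; apply: contrapT => E; apply: nxy => U xU.
apply: contrapT => nyU; apply: E; exists (stone_set U); split=> //.
by apply: clopup_stone_set; exact: prime_filter_open (prime_filterP x) _ xU.
Qed.

Lemma principal_prime_filter (q : P) :
  is_prime_filter [set U | open_up U /\ U q].
Proof.
split.
- by move=> U [].
- by split => //; exact: open_upT.
- by case.
- by move=> U V [oU Uq] [oV Vq]; split; [exact: open_upI|].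
- by move=> U V oV UV [_ /UV].
- by move=> U V oU oV [_ [Uq|Vq]]; [left|right].
Qed.

Definition principal (q : P) : prime_filter :=
  PrimeFilter (principal_prime_filter q).

(** On a basic neighbourhood given by [A] and [B], the set [S] intersected with [A] is not contained
    in [B], as otherwise [B] would belong to [x]. Any point of the difference serves as [q]. *)
Lemma principal_dense (S : set P) (N : set prime_filter) (x : prime_filter) :
  x S -> nbhs x N -> exists2 q, S q & N (principal q).
Proof.
move=> xS /nbhs_prime_filterE[A [B [xA oB nxB ABN]]].
have Px := prime_filterP x.
have [q [[Sq Aq] nBq]] : exists q, ((S `&` A) `\` B) q.
  apply: contrapT => E; apply: nxB.
  apply: (prime_filterS Px oB _ (prime_filterI Px xS xA)) => q SAq.
  by apply: contrapT => nBq; apply: E; exists q.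
exists q => //; apply: ABN; last by case.
by split=> //; exact: prime_filter_open Px _ xA.
Qed.

Lemma prime_filter_fspace : is_fspace prime_filter_le.
Proof.
split; first exact: prime_filter_priestley.
move=> W oW uW; pose D := [set U | open_up U /\ stone_set U `<=` W].
have oD : open_up (\bigcup_(U in D) U) by apply: open_up_bigcup => U [].
(* The right side is clopen and contains [W] by interpolation at points. Conversely, each of its
   points is a limit of principal filters of points of the sets [U] in [D], and these lie in [W]. *)
suff -> : closure W = stone_set (\bigcup_(U in D) U).
  by have [[]] := clopup_stone_set oD.
apply/seteqP; split.
  have [[_ /closure_id ->] _] := clopup_stone_set oD; apply: closureS => x Wx.
  have hX := priestley_hausdorff prime_filter_priestley.
  have [|U [oU xU UW]] := stone_set_interpolation (@closed_set1_hausdorff _ hX x) oW uW.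
    by move=> _ ->.
  apply: (prime_filterS (prime_filterP x) oD _ (xU x erefl)) => q Uq.
  by exists U.
move=> x xD N /(principal_dense xD)[q [U [oU UW] Uq] Nq].
by exists (principal q); split=> //; exact: UW.
Qed.

(** Convergence tested on open upsets only. The two clauses still pin down [q], because an open
    upset around [p] whose closure misses [q] exists whenever [p] is not below [q]. *)
Definition converges_to (x : prime_filter) (q : P) : Prop :=
  (forall U, open_up U -> U q -> x U) /\ (forall U, x U -> closure U q).

(** As [x] is prime, the differences of a member and a non-member generate a proper filter on [P],
    and any cluster point of it is a limit. The pairs [(setT, U)] and [(U, set0)] give the two
    clauses. *)
Lemma prime_filter_converges x : exists q, converges_to x q.
Proof.
have Px := prime_filterP x.
pose D := [set AB : set P * set P | [/\ x AB.1, open_up AB.2 & ~ x AB.2]].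
have PF : ProperFilter (filter_from D (fun AB => AB.1 `\` AB.2)).
  apply: filter_from_proper.
    apply: filter_from_filter.
      exists (setT, set0); split; [exact: prime_filterT|exact: open_up0|].
      exact: prime_filter0.
    move=> [A B] [A' B'] [/= xA oB nxB] [/= xA' oB' nxB'].
    exists (A `&` A', B `|` B'); first split => /=.
    - exact: prime_filterI.
    - exact: open_upU.
    - by move=> /(prime_filterU Px oB oB')[].
    - move=> z [/= [Az A'z] nBz]; split; split=> // Bz; apply: nBz; [left|right] => //.
  move=> [A B] [/= xA oB nxB]; apply: contrapT => E; apply: nxB.
  apply: (prime_filterS Px oB _ xA) => q Aq.
  by apply: contrapT => nBq; apply: E; exists q.
have [|q [_ clq]] := kps_compact (kps_axioms P) PF; first exact: filterT.
exists q; split=> [U oU Uq|U xU N qN].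
  apply: contrapT => nxU; have [||z [[_ nUz] Uz]] := clq (setT `\` U) U.
  - by exists (setT, U) => //; split=> //; exact: prime_filterT.
  - by apply: open_nbhs_nbhs; split=> //; case: oU.
  - by apply: nUz.
apply: clq qN; exists (U, set0) => /=; last by move=> z [].
by split=> //; [exact: open_up0|exact: prime_filter0].
Qed.

Definition cover_map (x : prime_filter) : P :=
  sval (cid (prime_filter_converges x)).

Lemma cover_map_open x U : open_up U -> U (cover_map x) -> x U.
Proof. by have [H _] := svalP (cid (prime_filter_converges x)); exact: H. Qed.

Lemma cover_map_closure (x : prime_filter) U : x U -> closure U (cover_map x).
Proof. by have [_ H] := svalP (cid (prime_filter_converges x)); exact: H. Qed.

Lemma kps_hausdorff : hausdorff_space P.
Proof. by have [_ oP cP] := kps_axioms P; exact: closed_order_hausdorff oP cP. Qed.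

Lemma kps_preorder : Relation_Definitions.preorder P le.
Proof. by have [_ [r t _] _] := kps_axioms P; split. Qed.

Lemma kps_open_upset_separation (p q : P) : ~ le p q ->
  exists U, [/\ open_up U, U p & ~ closure U q].
Proof.
have [cP _ clP] := kps_axioms P.
move/(open_upset_separation cP kps_hausdorff clP kps_preorder).
by move=> [U [oU uU Up nUq]]; exists U.
Qed.

Lemma cover_map_mono x y : prime_filter_le x y -> le (cover_map x) (cover_map y).
Proof.
move=> xy; apply: contrapT => /kps_open_upset_separation[U [oU Ux]]; apply.
exact/cover_map_closure/xy/cover_map_open.
Qed.

Lemma cover_map_principal q : cover_map (principal q) = q.
Proof.
have [_ [_ _ anti] _] := kps_axioms P.
apply: anti; apply: contrapT => /kps_open_upset_separation[U [oU Up]]; apply.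
  by have [_ Uq] := cover_map_open oU Up; exact: subset_closure.
exact: cover_map_closure.
Qed.

(** Order-normality supplies an open upset [U] such that [stone_set U], for an upset [V], or its
    complement, for a downset [V], is a neighbourhood of [x] mapped into [V]; the closure of [U]
    absorbs the gap in [cover_map_closure]. *)
Lemma cover_map_continuous : continuous cover_map.
Proof.
have [cP _ clP] := kps_axioms P.
apply: continuous_upset_downset (kps_axioms P) _ _ => V oV uV.
  rewrite openE => x Vx.
  have [||U [oU uU xU UV]] := open_upset_shrink cP kps_hausdorff clP kps_preorder
    (@closed_above _ _ cP kps_hausdorff clP _) _ oV (_ : le (cover_map x) `<=` V).
  - by move=> a b xa ab; have [_ t] := kps_preorder; exact: t xa ab.
  - by move=> z; exact: uV.
  have [[oS _] _] := clopup_stone_set (conj oU uU : open_up U).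
  apply: filterS (_ : nbhs x (stone_set U)).
    by move=> y /cover_map_closure /UV.
  apply: open_nbhs_nbhs; split=> //; apply: cover_map_open => //; apply: xU.
  by have [r _] := kps_preorder; exact: r.
rewrite openE => x Vx.
have [|||U [oU uU FU UV]] := open_upset_shrink cP kps_hausdorff clP kps_preorder
  (open_closedC oV) _ (_ : open (~` (le^~ (cover_map x)))).
- by move=> a b nVa ab Vb; apply: nVa; exact: uV Vb ab.
- by apply: closed_openC; exact: closed_below cP kps_hausdorff clP _.
- by move=> a nVa ax; apply: nVa; exact: uV Vx ax.
have nxU : ~ x U.
  move=> /cover_map_closure/UV; apply.
  by have [r _] := kps_preorder; exact: r.
have [[_ cS] _] := clopup_stone_set (conj oU uU : open_up U).
apply: filterS (_ : nbhs x (~` stone_set U)).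
  move=> y nyU /=; apply: contrapT => /FU Uy; apply: nyU.
  by apply: cover_map_open.
by apply: open_nbhs_nbhs; split=> //; exact: closed_openC.
Qed.

Definition cover_R (x y : prime_filter) : Prop := le (cover_map x) (cover_map y).

Lemma cover_ordered_gleason : is_ordered_gleason prime_filter_le cover_R.
Proof.
have [r t] := kps_preorder.
split.
- exact: prime_filter_fspace.
- have [_ _ clP] := kps_axioms P.
  suff : closed ((fun p : prime_filter * prime_filter =>
      (cover_map p.1, cover_map p.2)) @^-1` [set p : P * P | le p.1 p.2]) by [].
  apply: preimage_closed clP => z _.
  by apply: cvg_pair; (apply: continuous_comp; last exact: cover_map_continuous);
    [exact: cvg_fst|exact: cvg_snd].
- move=> x y z u /cover_map_mono xy yz /cover_map_mono zu.
  exact: t xy (t _ _ _ yz zu).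
- by split=> [x|x y z]; [exact: r|exact: t].
- move=> O cO; have [[oO clO] uO] := cO.
  have [V [oV OV VO]] := stone_set_interpolation clO oO uO (fun x Ox => Ox).
  have {OV VO} -> : O = stone_set V by apply/seteqP.
  have [[_ /closure_id clV] _] := clopup_stone_set oV.
  apply/seteqP; split; last first.
    rewrite [X in _ `<=` X]clV; apply: closureS => x /rboxP; apply; exact: r.
  (* The principal filter of [q] in [V] lies in [#(stone_set V)]: a filter [R]-above it has its
     limit above [q], hence in the open upset [V], which then belongs to it. *)
  move=> x xV N /(principal_dense xV)[q Vq Nq].
  exists (principal q); split=> //; apply/rboxP => y.
  rewrite /cover_R cover_map_principal => qy; apply: cover_map_open => //.
  by have [_ uV] := oV; exact: uV qy.
Qed.

Definition gleason_cover : ordered_gleason := OrderedGleason cover_ordered_gleason.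

End PrimeFilters.

(** * The equivalence *)

(** Order reflection and antisymmetry make [f] injective; the inverse is continuous because images
    of closed sets are compact, hence closed. *)
Lemma kps_is_iso (P Q : KPSp) (f : Hom P Q) :
  (forall q, exists p, sval f p = q) ->
  (forall x y, kps_le (sval f x) (sval f y) -> kps_le x y) -> is_iso f.
Proof.
move=> surj refl; have [cf mf] := svalP f.
have [_ [rP _ aP] _] := kps_axioms P.
have [g gK] := choice surj.
have Kg x : g (sval f x) = x.
  by apply: aP; apply: refl; rewrite gK; have [_ [r _ _] _] := kps_axioms Q; exact: r.
have gP : is_kps_morphism g.
  split; last by move=> x y xy; apply: refl; rewrite !gK.
  apply/continuous_closedP => A cA.
  have -> : g @^-1` A = sval f @` A.
    apply/seteqP; split=> [q Agq|_ [p Ap <-]]; first by exists (g q).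
    by rewrite /= Kg.
  apply: (compact_closed (@kps_hausdorff Q)); apply: continuous_compact.
    by apply: continuous_subspaceT => x; exact: cf.
  exact: subclosed_compact cA (kps_compact (kps_axioms P)) _.
exists (exist _ g gP); split; apply: sval_inj; apply/funext => x.
- exact: Kg.
- exact: gK.
Qed.

(** [cover_R] is the order of [P] pulled back along [cover_map], so the factor of [cover_map]
    through the quotient reflects the order; principal filters make it surjective. *)
Lemma gleason_cover_iso (P : KPSp) :
  exists e : @Hom KPSp (xi_obj (gleason_cover P)) P, is_iso e.
Proof.
pose X := gleason_cover P; pose p : X -> P := @cover_map P.
have [_ [rP _ aP] _] := kps_axioms P.
pose e (a : xi_obj X) : P := p (sval (cid (ogl_class_surj a))).
have eE x : e (ogl_class x) = p x.
  rewrite /e; have /= E := svalP (cid (ogl_class_surj (ogl_class x))).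
  by have [xy yx] := (ogl_classP x _).1 E; exact: aP.
have eP : is_kps_morphism e.
  split.
    apply/continuousP => V oV; apply: ogl_quot_open.
    suff -> : ogl_class (X:=X) @^-1` (e @^-1` V) = p @^-1` V.
      by have /continuousP := @cover_map_continuous P; apply.
    by apply/seteqP; split=> x /=; rewrite eE.
  move=> a b; have [x ->] := ogl_class_surj a; have [y ->] := ogl_class_surj b.
  by move=> /ogl_quot_leE; rewrite !eE.
exists (exist _ e eP : @Hom KPSp (xi_obj X) P); apply: kps_is_iso.
  move=> q; exists (ogl_class (principal q : X)); rewrite -[LHS]/(e _) eE.
  exact: cover_map_principal.
move=> a b; have [x ->] := ogl_class_surj a; have [y ->] := ogl_class_surj b.
rewrite -[sval _ (ogl_class x)]/(e _) -[sval _ (ogl_class y)]/(e _) !eE => xy.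
exact/ogl_quot_leE.
Qed.

Lemma fully_faithful_equivalence (C D : category) (F : functor C D)
    (lift : forall A B : C, Hom (F A) (F B) -> Hom A B) :
  (forall (A B : C) (f : Hom A B), lift A B (fmap F f) = f) ->
  (forall (A B : C) (g : Hom (F A) (F B)), fmap F (lift A B g) = g) ->
  (forall d : D, exists (c : C) (e : Hom (F c) d), is_iso e) ->
  is_equivalence F.
Proof.
move=> fmapK liftK surj.
have [Fid Fcomp] := fmapP F.
have inj (A B : C) (f g : Hom A B) : fmap F f = fmap F g -> f = g.
  by move=> E; rewrite -(fmapK _ _ f) E fmapK.
pose G0 d := sval (cid (surj d)).
pose e d : Hom (F (G0 d)) d := sval (cid (svalP (cid (surj d)))).
have eI d : is_iso (e d) by exact: (svalP (cid (svalP (cid (surj d))))).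
pose e' d : Hom d (F (G0 d)) := sval (cid (eI d)).
have e'e d : comp (e' d) (e d) = idm _ by have [] := svalP (cid (eI d)).
have ee' d : comp (e d) (e' d) = idm _ by have [] := svalP (cid (eI d)).
(* The quasi-inverse conjugates [f] by the chosen isomorphisms and lifts the result through the
   bijection on hom-sets. *)
pose G1 (A B : D) (f : Hom A B) : Hom (G0 A) (G0 B) :=
  lift _ _ (comp (e' B) (comp f (e A))).
have FG1 A B (f : Hom A B) : fmap F (G1 A B f) = comp (e' B) (comp f (e A)).
  exact: liftK.
have GP : is_functor G1.
  split=> [A|A B E g f]; apply: inj; rewrite ?Fcomp !FG1.
    by rewrite comp_idl e'e Fid.
  rewrite -!comp_assoc; do 2 congr comp.
  by rewrite [RHS]comp_assoc ee' comp_idl.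
have nat B (A : D) (f : Hom A B) :
    comp (e B) (comp (e' B) (comp f (e A))) = comp f (e A).
  by rewrite comp_assoc ee' comp_idl.
exists (Functor GP); split.
- exists (fun A => lift _ _ (e (F A))); split=> [A B f|A] /=.
    by apply: inj; rewrite !Fcomp FG1 !liftK nat.
  exists (lift _ _ (e' (F A))).
  by split; apply: inj; rewrite Fcomp !liftK Fid.
- exists e; split=> [A B f|A] //=.
  by rewrite FG1 nat.
Qed.

(** * The functor on morphisms and the equivalence *)

Section InducedMap.
Variables X Y : ordered_gleason.

Definition hom_of_map (f : kps_hom (xi_obj X) (xi_obj Y)) : ogl_hom X Y :=
  exist _ _ (rel_of_map_morphism (svalP f)).

Lemma induced_map_subproof (rho : ogl_hom X Y) :
  exists f : kps_hom (xi_obj X) (xi_obj Y), induces (sval rho) (sval f).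
Proof.
have [f rf] := morphism_induces_exists (svalP rho).
by exists (exist _ f (induces_kps_morphism (svalP rho) rf)).
Qed.

Definition induced_map (rho : ogl_hom X Y) : kps_hom (xi_obj X) (xi_obj Y) :=
  sval (cid (induced_map_subproof rho)).

Lemma induced_mapP rho : induces (sval rho) (sval (induced_map rho)).
Proof. exact: (svalP (cid (induced_map_subproof rho))). Qed.

Lemma hom_of_mapK : cancel hom_of_map induced_map.
Proof.
move=> f; apply: sval_inj; apply: induces_inj (induced_mapP _) _.
exact: rel_of_map_induces (svalP f).
Qed.

Lemma induced_mapK : cancel induced_map hom_of_map.
Proof.
move=> rho; apply: sval_inj.
by rewrite /= (rel_of_map_induced (svalP rho) (@induced_mapP rho)).
Qed.

End InducedMap.

(** A relation induces at most one map, so it is enough that the identity and the composite map are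
    induced by the order and by [star]. *)
Lemma induced_map_functor :
  @is_functor (OGlSp ogl_laws) KPSp xi_obj induced_map.
Proof.
split=> [X|X Y Z g f]; apply: sval_inj; apply: induces_inj (induced_mapP _) _ => /=.
  rewrite -rel_of_map_id; apply: rel_of_map_induces; exact: kps_morphism_id.
rewrite -{1}(induced_mapK g) -{1}(induced_mapK f) /=.
rewrite (star_rel_of_map (svalP (induced_map g)) (svalP (induced_map f))).
apply: rel_of_map_induces.
exact: kps_morphism_comp (svalP (induced_map g)) (svalP (induced_map f)).
Qed.

Theorem mainTheorem2 :
  exists (L : OGlSp_laws)
    (xi_mor : forall X Y : OGlSp L,
       @Hom (OGlSp L) X Y -> @Hom KPSp (xi_obj X) (xi_obj Y)),
    (forall (X Y : OGlSp L) (rho : @Hom (OGlSp L) X Y),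
       induces (proj1_sig rho) (proj1_sig (xi_mor X Y rho))) /\
    exists xiP : @is_functor (OGlSp L) KPSp xi_obj xi_mor,
      is_equivalence (Functor xiP).
Proof.
exists ogl_laws, induced_map; split; first by move=> X Y rho; exact: induced_mapP.
exists induced_map_functor.
apply: (@fully_faithful_equivalence (OGlSp ogl_laws) KPSp
  (Functor induced_map_functor) hom_of_map).
- by move=> X Y; exact: induced_mapK.
- by move=> X Y; exact: hom_of_mapK.
- by move=> P; exists (gleason_cover P); exact: gleason_cover_iso.
Qed.
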